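(* Let $\mathbf{M}=\begin{pmatrix}A&B\\C&D\end{pmatrix}$ be a real $2N\times 2N$ free symplectic matrix, i.e. $A,B,C,D$ are real $N\times N$ matrices with $AB^{T}=BA^{T}$, $CD^{T}=DC^{T}$, $AD^{T}-BC^{T}=I_{N}$ and $\det(B)\neq 0$. For any two signals $f(\mathbf{t})$ and $g(\mathbf{t})$ on $\mathbb{R}^N$, let $z(\mathbf{t})=(f\ast^{\mathbf{M}}g)(\mathbf{t})$, where the free metaplectic convolution $\ast^{\mathbf{M}}$ is defined by $$(f\ast^{\mathbf{M}}g)(\mathbf{t})=\frac{\sqrt{2}}{|\det(B)|^{1/2}}\int_{\mathbb{R}^N}f(\boldsymbol{\tau})\,g(\sqrt{2}\,\mathbf{t}-\boldsymbol{\tau})\,e^{2\pi i\left(\frac{\mathbf{t}}{\sqrt2}-\boldsymbol{\tau}\right)B^{-1}A\left(\frac{\mathbf{t}}{\sqrt2}-\boldsymbol{\tau}\right)^T}\,d\boldsymbol{\tau},$$ and let $Z_{\mathbf{M}}$, $F_{\mathbf{M}}$ and $G_{\mathbf{M}}$ denote the free metaplectic transformations (FMT) of $z$, $f$ and $g$, respectively. Then $$Z_{\mathbf{M}}(\mathbf{u})=F_{\mathbf{M}}\left(\frac{\mathbf{u}}{\sqrt2}\right)\cdot G_{\mathbf{M}}\left(\frac{\mathbf{u}}{\sqrt2}\right),$$ and $$z(\mathbf{t})=\mathcal{L}_{\mathbf{M}^{-1}}\left[F_{\mathbf{M}}\left(\frac{\mathbf{u}}{\sqrt2}\right)\cdot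 G_{\mathbf{M}}\left(\frac{\mathbf{u}}{\sqrt2}\right)\right](\mathbf{t}).$$
   Context: Vectors $\mathbf{t}=(t_1,\dots,t_N)$, $\mathbf{u}=(u_1,\dots,u_N)$, $\boldsymbol{\tau}$ in $\mathbb{R}^N$ are row vectors; $I_N$ is the $N\times N$ identity matrix; $X^{-T}=(X^{-1})^T$. FMT: the free metaplectic transformation of a signal $f$ with symplectic matrix $\mathbf{M}$ ($\det(B)\neq0$) is $$\mathcal{L}_{\mathbf{M}}[f(\mathbf{t})](\mathbf{u})=F_{\mathbf{M}}(\mathbf{u})=\frac{1}{|\det(B)|^{1/2}}\int_{\mathbb{R}^N}f(\mathbf{t})\,e^{\pi i(\mathbf{u}DB^{-1}\mathbf{u}^T+\mathbf{t}B^{-1}A\mathbf{t}^T)-2\pi i\,\mathbf{t}B^{-1}\mathbf{u}^T}\,d\mathbf{t}.$$ Inverse FMT: with $\mathbf{M}^{-1}=\begin{pmatrix}D^T&-B^T\\-C^T&A^T\end{pmatrix}$, the operator $\mathcal{L}_{\mathbf{M}^{-1}}$ is given on a function $H(\mathbf{u})$ by $$\mathcal{L}_{\mathbf{M}^{-1}}[H(\mathbf{u})](\mathbf{t})=\frac{1}{|\det(B)|^{1/2}}\int_{\mathbb{R}^N}H(\mathbf{u})\,e^{-\pi i(\mathbf{u}B^{-T}D^T\mathbf{u}^T+\mathbf{t}A^TB^{-T}\mathbf{t}^T)+2\pi i\,\mathbf{u}B^{-T}\mathbf{t}^T}\,d\mathbf{u},$$ and the inversion formula reads $f(\mathbf{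t})=\mathcal{L}_{\mathbf{M}^{-1}}[F_{\mathbf{M}}(\mathbf{u})](\mathbf{t})$.
   Formalization: The factor √2 in the convolution is replaced by (√2)^N (the stated constant fails for N ≥ 2, e.g. Gaussians with B = I, A = D = 0); signals are taken in L¹(R^N), and the second formula holds for almost every t when the product of the two FMTs is integrable. *)

(* Defs.v *)
From HB Require Import structures.
From mathcomp Require Import all_boot all_order all_algebra.
From mathcomp Require Import complex.
From mathcomp Require Import all_classical all_reals all_analysis.

Set Implicit Arguments.
Unset Strict Implicit.
Unset Printing Implicit Defensive.

Import Order.TTheory GRing.Theory Num.Theory.
Import numFieldNormedType.Exports.

Local Open Scope classical_set_scope.
Local Open Scope ring_scope.
Local Open Scope complex_scope.

Definition measure_rV_display : measure_display -> measure_display.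
Proof. exact. Qed.

(* Row vectors carry the sigma-algebra generated by the coordinate maps; for *)
(* T = R this is the Borel sigma-algebra of R^n.                             *)
Section measurable_rV.
Context {d} {T : measurableType d}.
Variable n : nat.

Let coord_rV : 'I_n -> 'rV[T]_n -> T := fun i v => v ord0 i.

Let rV_set0 : g_sigma_preimage coord_rV set0.
Proof. exact: sigma_algebra0. Qed.

Let rV_setC A : g_sigma_preimage coord_rV A -> g_sigma_preimage coord_rV (~` A).
Proof. exact: sigma_algebraC. Qed.

Let rV_bigcup (F : _^nat) : (forall i, g_sigma_preimage coord_rV (F i)) ->
  g_sigma_preimage coord_rV (\bigcup_i (F i)).
Proof. exact: sigma_algebra_bigcup. Qed.

HB.instance Definition _ := @isMeasurable.Build (measure_rV_display d)
  'rV[T]_n (g_sigma_preimage coord_rV) rV_set0 rV_setC rV_bigcup.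

Lemma measurable_coord_rV (i : 'I_n) :
  measurable_fun setT (fun v : 'rV[T]_n => v ord0 i).
Proof.
move=> _ Y mY; rewrite setTI; apply: sub_sigma_algebra => /=.
rewrite -bigcup_seq/=; exists i => /=; first by rewrite mem_index_enum.
by exists Y => //; rewrite setTI.
Qed.

Lemma measurable_fun_rV d' (T' : measurableType d') (f : T' -> 'rV[T]_n) :
  (forall i, measurable_fun setT (fun x => f x ord0 i)) -> measurable_fun setT f.
Proof.
move=> mf _ A mA; rewrite setTI.
pose G : set (set 'rV[T]_n) := [set B | measurable (f @^-1` B)].
suff : measurable `<=` G by exact.
apply: smallest_sub.
  split; rewrite /G /=.
  - by rewrite preimage_set0.
  - by move=> B mB; rewrite setTD preimage_setC; exact: measurableC.
  - by move=> F mF; rewrite preimage_bigcup; exact: bigcup_measurable.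
move=> B; rewrite -bigcup_seq/= => -[i _ [C mC <-]].
by rewrite /G /= setTI -[X in measurable X]setTI; exact: mf.
Qed.

End measurable_rV.

Section lebesgue_cons.
Context {R : realType}.
Variable n : nat.

Definition cons_rV (p : measurableTypeR R * 'rV[R]_n) : 'rV[R]_n.+1 :=
  row_mx (p.1 : R)%:M p.2.

Definition uncons_rV (v : 'rV[R]_n.+1) : measurableTypeR R * 'rV[R]_n :=
  (v ord0 ord0, \row_j v ord0 (lift ord0 j)).

Lemma cons_rV0 p : cons_rV p ord0 ord0 = p.1.
Proof.
have -> : (ord0 : 'I_n.+1) = lshift n (ord0 : 'I_1) by exact: val_inj.
by rewrite /cons_rV (row_mxEl (n1 := 1) (n2 := n)) mxE eqxx.
Qed.

Lemma cons_rVS p j : cons_rV p ord0 (lift ord0 j) = p.2 ord0 j.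
Proof.
have -> : lift ord0 j = rshift 1 j by exact: val_inj.
by rewrite /cons_rV (row_mxEr (n1 := 1) (n2 := n)).
Qed.

Lemma cons_rVK : cancel cons_rV uncons_rV.
Proof.
move=> [x v]; rewrite /uncons_rV cons_rV0; congr pair.
by apply/rowP => j; rewrite mxE cons_rVS.
Qed.

Lemma measurable_cons_rV : measurable_fun setT cons_rV.
Proof.
apply: measurable_fun_rV => i; case: (unliftP ord0 i) => [j|] ->.
  under eq_fun do rewrite cons_rVS.
  apply: (measurableT_comp (f := fun v : 'rV[R]_n => v ord0 j)) => //.
  exact: measurable_coord_rV.
by under eq_fun do rewrite cons_rV0; exact: measurable_fst.
Qed.

Lemma measurable_uncons_rV : measurable_fun setT uncons_rV.
Proof.
apply/measurable_fun_pairP; split; first exact: measurable_coord_rV.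
apply: measurable_fun_rV => j /=.
by under eq_fun do rewrite mxE; exact: measurable_coord_rV.
Qed.

HB.instance Definition _ :=
  isMeasurableFun.Build _ _ _ _ cons_rV measurable_cons_rV.

Variable mu : {sigma_finite_measure set 'rV[R]_n -> \bar R}.

Definition lebesgue_cons : set 'rV[R]_n.+1 -> \bar R :=
  pushforward (lebesgue_measure \x mu)%E cons_rV.

Let lebesgue_cons0 : lebesgue_cons set0 = 0%E.
Proof. exact: measure0. Qed.

Let lebesgue_cons_ge0 A : (0 <= lebesgue_cons A)%E.
Proof. exact: measure_ge0. Qed.

Let lebesgue_cons_sigma_additive : semi_sigma_additive lebesgue_cons.
Proof. exact: measure_semi_sigma_additive. Qed.

HB.instance Definition _ := isMeasure.Build _ _ _ lebesgue_cons
  lebesgue_cons0 lebesgue_cons_ge0 lebesgue_cons_sigma_additive.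

Let lebesgue_cons_sigma_finite : sigma_finite setT lebesgue_cons.
Proof.
have /sigma_finiteP[F [TF ndF Foo]] := sigma_finiteT (@lebesgue_measure R).
have /sigma_finiteP[G [TG ndG Goo]] := sigma_finiteT mu.
exists (fun k => @uncons_rV @^-1` (F k `*` G k)).
  apply/esym; rewrite -subTset => v _.
  have [i _ Fix] : (\bigcup_i F i) (uncons_rV v).1 by rewrite -TF.
  have [j _ Gjw] : (\bigcup_i G i) (uncons_rV v).2 by rewrite -TG.
  exists (maxn i j) => //; split.
    by move: Fix; exact/subsetPset/ndF/leq_maxl.
  by move: Gjw; exact/subsetPset/ndG/leq_maxr.
move=> k; have [mFk Fkoo] := Foo k; have [mGk Gkoo] := Goo k.
have mFG : measurable (F k `*` G k) by exact: measurableX.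
split.
  by rewrite -[X in measurable X]setTI; exact: measurable_uncons_rV.
rewrite /lebesgue_cons /pushforward -comp_preimage.
rewrite (_ : _ @^-1` _ = F k `*` G k).
  by rewrite product_measure1E// lte_mul_pinfty// ge0_fin_numE.
by rewrite (_ : _ \o _ = id) //; apply/funext => p /=; rewrite cons_rVK.
Qed.

HB.instance Definition _ := @Measure_isSigmaFinite.Build _ _ _ lebesgue_cons
  lebesgue_cons_sigma_finite.

End lebesgue_cons.

Fixpoint lebesgue_rV (R : realType) (n : nat) :
    {sigma_finite_measure set 'rV[R]_n -> \bar R} :=
  match n with
  | 0 => \d_(0 : 'rV[R]_0)
  | n.+1 => lebesgue_cons (lebesgue_rV R n)
  end.

(* This characterizes the n-dimensional Lebesgue measure.                    *)
Lemma lebesgue_rV_box (R : realType) n (A : 'I_n -> set (measurableTypeR R)) :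
  (forall i, measurable (A i)) ->
  lebesgue_rV R n [set v | forall i, A i (v ord0 i)] =
  (\prod_(i < n) lebesgue_measure (A i))%E.
Proof.
elim: n A => [|n IHn] A mA.
  by rewrite big_ord0 /= diracE mem_set // => -[].
have mB : measurable [set v : 'rV[R]_n | forall i, A (lift ord0 i) (v ord0 i)].
  have -> : [set v : 'rV[R]_n | forall i, A (lift ord0 i) (v ord0 i)] =
      \bigcap_(i in [set: 'I_n]) (fun v : 'rV[R]_n => v ord0 i) @^-1`
        A (lift ord0 i).
    by apply/seteqP; split => v /= h i; [move=> _|]; exact: h.
  apply: fin_bigcap_measurable => [|i _]; first exact: (@finite_finset 'I_n).
  have := @measurable_coord_rV _ R n i measurableT _ (mA (lift ord0 i)).
  by rewrite setTI.
rewrite big_ord_recl -IHn // -product_measure1E //=.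
congr (product_measure1 _ _ _); apply/seteqP; split=> -[x v] /= h.
  by split => [|i]; [have := h ord0; rewrite cons_rV0
                    |have := h (lift ord0 i); rewrite cons_rVS].
by move=> i; case: (unliftP ord0 i) => [j|] ->;
  [rewrite cons_rVS; exact: h.2 | rewrite cons_rV0; exact: h.1].
Qed.

Section complex_integral.
Context d (T : measurableType d) (R : realType).
Variable mu : {measure set T -> \bar R}.
Implicit Type f : T -> R[i].

(* Absolute integrability, i.e. f is in L^1(mu).                            *)
Definition cintegrable f :=
  mu.-integrable setT (EFin \o (@complex.Re R \o f)) /\
  mu.-integrable setT (EFin \o (@complex.Im R \o f)).

Definition cintegral f : R[i] :=
  (\int[mu]_x complex.Re (f x))%R +i* (\int[mu]_x complex.Im (f x))%R.

End complex_integral.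

(* e^{ix} for real x *)
Definition expi {R : realType} (x : R) : R[i] := cos x +i* sin x.

Section free_metaplectic.
Context {R : realType} {N : nat}.
Implicit Types (M : 'M[R]_(N + N)) (f g H : 'rV[R]_N -> R[i]) (t u : 'rV[R]_N).

(* x P y^T *)
Definition bform (x : 'rV[R]_N) (P : 'M[R]_N) (y : 'rV[R]_N) : R :=
  (x *m P *m y^T) ord0 ord0.

Definition free_symplectic M :=
  let A := ulsubmx M in let B := ursubmx M in
  let C := dlsubmx M in let D := drsubmx M in
  [/\ A *m B^T = B *m A^T, C *m D^T = D *m C^T,
      A *m D^T - B *m C^T = 1%:M & \det B != 0].

(* L_M for M = (A B; C D). *)
Definition fmt M f u : R[i] :=
  let A := ulsubmx M in let B := ursubmx M in let D := drsubmx M in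
  ((Num.sqrt `|\det B|)^-1)%:C *
  cintegral (lebesgue_rV R N) (fun t => f t *
    expi (pi * (bform u (D *m invmx B) u + bform t (invmx B *m A) t)
          - 2 * pi * bform t (invmx B) u)).

(* L_{M^-1}: the kernel of fmt for M^-1 = (D^T -B^T; -C^T A^T).              *)
Definition ifmt M H t : R[i] :=
  let A := ulsubmx M in let B := ursubmx M in let D := drsubmx M in
  ((Num.sqrt `|\det B|)^-1)%:C *
  cintegral (lebesgue_rV R N) (fun u => H u *
    expi (- pi * (bform u ((invmx B)^T *m D^T) u
                  + bform t (A^T *m (invmx B)^T) t)
          + 2 * pi * bform u (invmx B)^T t)).

(* The free metaplectic convolution. The factor is sqrt 2 ^ N, i.e. the      *)
(* Jacobian of t |-> sqrt 2 *: t on R^N, which is sqrt 2 in dimension 1.     *)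
Definition fmconv M f g t : R[i] :=
  let A := ulsubmx M in let B := ursubmx M in
  (Num.sqrt 2 ^+ N / Num.sqrt `|\det B|)%:C *
  cintegral (lebesgue_rV R N) (fun tau =>
    let s := (Num.sqrt 2)^-1 *: t - tau in
    f tau * g (Num.sqrt 2 *: t - tau) *
    expi (2 * pi * bform s (invmx B *m A) s)).

End free_metaplectic.

(* Main.v *)
Require Import Defs.
From mathcomp Require Import all_boot all_order all_algebra.
From mathcomp Require Import complex.
From mathcomp Require Import all_classical all_reals all_analysis.
From mathcomp Require Import perm.
From mathcomp Require Import measurable_realfun.
From mathcomp Require Import ring lra zify.

Import Order.TTheory GRing.Theory Num.Theory.
Import numFieldNormedType.Exports.

Local Open Scope classical_set_scope.
Local Open Scope ring_scope.
Local Open Scope complex_scope.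

(**
Write P = B^-1 A, and let the chirp of f be f(t) e^{i pi t P t^T}. Up to a
unimodular factor and the constant |det B|^{-1/2}, the FMT of f at u is the
Fourier transform of its chirp at u B^-T. By the parallelogram identity for
the form t P t^T, the chirp of f *^M g is a constant multiple of
t |-> int F(tau) G(sqrt 2 t - tau) dtau, with F and G the chirps of f and g,
so the product formula is the classical convolution theorem (Fubini and an
affine substitution).

The reconstruction formula then follows, through the substitution
w = u B^-T, from the almost everywhere Fourier inversion theorem for h in L^1
with integrable transform H. For a box Q, let Phi_e be the product of
e^{-e|w_i|} with the inverse transform of the indicator of Q; by Fubini,
int H Phi_e equals the integral of h against a product of differences of
arctangents (the Laplace kernel transforms into the Poisson kernel). As e
tends to 0, dominated convergence turns this into
int_Q h = int_Q (inverse transform of H), and boxes determine integrable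
functions almost everywhere.
*)

(** Both substitutions call for the rule with factor |det Q| on row vectors, while [lebesgue_rV] is
    an iterated product known through its values on boxes. The rule is obtained from a triangular
    factorisation of Q, a triangular matrix being handled one coordinate at a time. The inverse
    transform of the indicator of an interval decays only like 1/|w|. It is not integrable, and
    Fubini does not apply to it directly: hence the damping e^{-e|w_i|}. The Laplace kernel is
    chosen because the integrals it leads to are elementary, and the arctangents they produce are
    bounded and converge pointwise away from the endpoints of the interval. Testing against boxes
    instead of evaluating at points lets the argument run for h that is merely integrable, and makes
    the integrals of the test functions factor over the coordinates. *)

Set Implicit Arguments.
Unset Strict Implicit.
Unset Printing Implicit Defensive.

(** * Uniqueness of measures agreeing on boxes *)

Section boxes.
Context {R : realType} {n : nat}.
Implicit Types a b : 'I_n -> R.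

Definition box a b : set 'rV[R]_n :=
  [set v | forall i, v ord0 i \in `]a i, b i]].

Lemma boxE a b :
  box a b = [set v | forall i, `]a i, b i]%classic (v ord0 i)].
Proof. by apply/seteqP; split => v /= h i; exact: h. Qed.

Lemma measurable_prod_rV (A : 'I_n -> set (measurableTypeR R)) :
  (forall i, measurable (A i)) ->
  measurable [set v : 'rV[R]_n | forall i, A i (v ord0 i)].
Proof.
move=> mA.
have -> : [set v : 'rV[R]_n | forall i, A i (v ord0 i)] =
    \bigcap_(i in [set: 'I_n]) (fun v : 'rV[R]_n => v ord0 i) @^-1` A i.
  by apply/seteqP; split => v /= h i; [move=> _|]; exact: h.
apply: fin_bigcap_measurable => [|i _]; first exact: (@finite_finset 'I_n).
have := @measurable_coord_rV _ (measurableTypeR R) n i measurableT _ (mA i).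
by rewrite setTI.
Qed.

Lemma measurable_box a b : measurable (box a b).
Proof. rewrite boxE.
exact: (@measurable_prod_rV (fun i => `]a i, b i]%classic)). Qed.

Lemma lebesgue_box a b :
  lebesgue_rV R n (box a b) =
  (\prod_(i < n) lebesgue_measure `]a i, b i]%classic)%E.
Proof.
rewrite boxE.
exact: (@lebesgue_rV_box _ _ (fun i => `]a i, b i]%classic)).
Qed.

Lemma lebesgue_box_lty a b : (lebesgue_rV R n (box a b) < +oo)%E.
Proof.
rewrite lebesgue_box.
suff /andP[] : (0 <= \prod_(i < n) lebesgue_measure `]a i, b i]%classic < +oo)%E.
  by [].
apply: (big_ind (fun x : \bar R => 0 <= x < +oo)%E).
- by rewrite lee_fin ler01 ltry.
- move=> x y /andP[x0 xoo] /andP[y0 yoo]; rewrite mule_ge0//=.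
  by rewrite lte_mul_pinfty// ge0_fin_numE.
- move=> i _; rewrite measure_ge0/= lebesgue_measure_itv/=.
  by case: ifP => // _; rewrite -EFinB ltry.
Qed.

Lemma boxI a b c d :
  box a b `&` box c d =
  box (fun i => Num.max (a i) (c i)) (fun i => Num.min (b i) (d i)).
Proof.
apply/seteqP; split => v /=.
  move=> [h k] i; move: (h i) (k i); rewrite !in_itv/= gt_max le_min.
  by move=> /andP[-> ->] /andP[-> ->].
move=> h; split => i; move: (h i); rewrite !in_itv/= gt_max le_min;
  by move=> /andP[/andP[? ?] /andP[? ?]]; exact/andP.
Qed.

Definition cube (k : nat) : set 'rV[R]_n :=
  box (fun=> - k%:R) (fun=> k%:R).

Lemma bigcup_cube : \bigcup_k cube k = setT.
Proof.
rewrite -subTset => v _.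
exists (Num.bound (\sum_i `|v ord0 i|)) => // i.
rewrite in_itv/=.
have h : `|v ord0 i| < (Num.bound (\sum_i `|v ord0 i|))%:R.
  apply: le_lt_trans (archi_boundP _); last exact: sumr_ge0.
  by rewrite (bigD1 i)//= lerDl sumr_ge0.
by move: h; rewrite ltr_norml => /andP[-> /ltW ->].
Qed.

(** Boxes are stable under intersection, so being generators makes them a pi-system that determines
    measures and, in [ae_eq_box], integrals. *)
Lemma measurable_rV_boxE :
  @measurable _ 'rV[measurableTypeR R]_n =
  <<s [set X | exists a b, X = box a b] >>.
Proof.
apply/seteqP; split => [A mA|]; last first.
  apply: smallest_sub; first exact: sigma_algebra_measurable.
  by move=> _ [a [b ->]]; exact: measurable_box.
pose T := g_sigma_algebraType [set X : set 'rV[R]_n | exists a b, X = box a b].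
have mbox a b : @measurable _ T (box a b).
  by apply: sub_sigma_algebra; exists a, b.
suff : @measurable _ 'rV[measurableTypeR R]_n `<=` (@measurable _ T).
  by move=> /(_ _ mA).
apply: smallest_sub; first exact: sigma_algebra_measurable.
move=> B; rewrite -bigcup_seq/= => -[i _ [C mC <-]].
rewrite setTI.
suff : (@measurable _ (measurableTypeR R)) `<=`
    [set C | @measurable _ T ((fun v : 'rV[R]_n => v ord0 i) @^-1` C)].
  by move=> /(_ _ mC).
apply: smallest_sub.
  split => /=.
  - by rewrite preimage_set0; exact: measurable0.
  - by move=> D mD; rewrite setTD preimage_setC; exact: measurableC.
  - by move=> F mF; rewrite preimage_bigcup; exact: bigcup_measurable.
move=> _ [[x y] _ <-] /=.
(* A slab is the union of the boxes that confine the other coordinates to []-k, k]]. *)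
have -> : (fun v : 'rV[R]_n => v ord0 i) @^-1` `]x, y] =
    \bigcup_k (box (fun j => if j == i then x else - k%:R)
                   (fun j => if j == i then y else k%:R)).
  apply/seteqP; split => v /= h.
    have [k _ hk] : (\bigcup_k cube k) v by rewrite bigcup_cube.
    by exists k => // j; case: eqP => [->//|_]; exact: hk.
  by have [k _ /(_ i)] := h; rewrite eqxx.
by apply: bigcup_measurable => k _; exact: mbox.
Qed.

Lemma measure_box_unique (m1 m2 : {measure set 'rV[R]_n -> \bar R}) :
  (forall a b, m1 (box a b) = m2 (box a b)) ->
  (forall k, m1 (cube k) < +oo)%E ->
  forall A, measurable A -> m1 A = m2 A.
Proof.
move=> m12 m1oo A mA.
apply: (measure_unique _ cube measurable_rV_boxE) => //.
- move=> _ _ [a [b ->]] [c [d ->]]; rewrite boxI.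
  by eexists; eexists.
- by move=> k; eexists; eexists.
- exact: bigcup_cube.
- by move=> _ [a [b ->]].
Qed.

End boxes.

(** * Linear change of variables for Lebesgue measure on R^n *)

(** Bundles the pushforward as a measure from an explicit proof of measurability. It is transparent,
    so its values unfold to those of [m] on preimages. *)
Definition image_measure d d' (T : measurableType d) (T' : measurableType d')
    (R : realType) (m : {measure set T -> \bar R}) (f : T -> T')
    (mf : measurable_fun setT f) : {measure set T' -> \bar R}.
Proof. by refine (pushforward m f : {measure set T' -> \bar R}). Defined.

Section affine_change.
Context {R : realType}.
Local Notation lambda := (@lebesgue_measure R).
Local Notation mu := (lebesgue_rV R _).

(** Both sides are measures in [A], so half-open intervals suffice. A negative [p] exchanges the
    ends: the preimage is then closed on the left, with the same length. *)
Lemma lebesgue_measure_affine (p q : R) (A : set (measurableTypeR R)) :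
  p != 0 -> measurable A ->
  ((`|p|%R)%:E * lambda ((fun x => p * x + q)%R @^-1` A) = lambda A)%E.
Proof.
move=> p0 mA.
have mf : measurable_fun setT
    ((fun x => p * x + q) : measurableTypeR R -> measurableTypeR R).
  by apply: measurable_funD => //; exact: mulrl_measurable.
pose np := NngNum (normr_ge0 p).
pose m : {measure set measurableTypeR R -> \bar R} :=
  mscale np (image_measure lambda mf).
suff h X : ocitv X -> lambda X = m X.
  by have /esym := lebesgue_measure_unique h mA.
move=> [[a b] _ <-].
have -> : m `]a, b]%classic =
    ((`|p|%R)%:E * lambda [set x | (p * x + q)%R \in `]a, b]])%E by [].
have [p1|p1|] := ltgtP p 0; last by move/eqP: (p0).
- rewrite [X in (_ * lambda X)%E](_ : _ = `[(b - q) / p, (a - q) / p[%classic).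
    rewrite !lebesgue_measure_itv/= !lte_fin ltr_nM2r ?invr_lt0//.
    rewrite ltrD2r ltr0_norm//; case: ifP => _; last by rewrite mule0.
    by rewrite -!EFinD -EFinM; congr EFin; field.
  apply/seteqP; split => x /=; rewrite !in_itv/=;
    by rewrite ler_ndivrMr// ltr_ndivlMr// lerBrDr ltrBlDr mulrC andbC.
- rewrite [X in (_ * lambda X)%E](_ : _ = `](a - q) / p, (b - q) / p]%classic).
    rewrite !lebesgue_measure_itv/= !lte_fin ltr_pM2r ?invr_gt0//.
    rewrite ltrD2r gtr0_norm//; case: ifP => _; last by rewrite mule0.
    by rewrite -!EFinD -EFinM; congr EFin; field.
  apply/seteqP; split => x /=; rewrite !in_itv/=;
    by rewrite ltr_pdivrMr// ler_pdivlMr// lerBrDr ltrBlDr mulrC.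
Qed.

Lemma measurable_affine n m (Q : 'M[R]_(n, m)) (c : 'rV[R]_m) :
  measurable_fun setT (fun v : 'rV[R]_n => v *m Q + c).
Proof.
apply: measurable_fun_rV => j.
under eq_fun do rewrite !mxE.
apply: measurable_funD => //.
apply: measurable_sum => i; apply: measurable_funM => //.
exact: measurable_coord_rV.
Qed.

Lemma measurable_mulmx n m (Q : 'M[R]_(n, m)) :
  measurable_fun setT (fun v : 'rV[R]_n => v *m Q).
Proof. by have := measurable_affine Q 0; under eq_fun do rewrite addr0. Qed.

Lemma measurable_preimage_mulmx n m (Q : 'M[R]_(n, m)) (A : set 'rV[R]_m) :
  measurable A -> measurable ((fun v : 'rV[R]_n => v *m Q) @^-1` A).
Proof. by move=> mA; rewrite -[_ @^-1` _]setTI; exact: measurable_mulmx. Qed.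

Lemma lebesgue_rV_translation n (c : 'rV[R]_n) (A : set 'rV[R]_n) :
  measurable A -> mu ((fun v => v + c) @^-1` A) = mu A.
Proof.
move=> mA.
have mf : measurable_fun setT (fun v : 'rV[R]_n => v + c).
  have := measurable_affine 1%:M c.
  by under eq_fun do rewrite mulmx1.
have -> : mu ((fun v => v + c) @^-1` A) = image_measure mu mf A by [].
have boxc a b : (fun v => v + c) @^-1` box a b =
    box (fun i => a i - c ord0 i) (fun i => b i - c ord0 i).
  by apply/seteqP; split => v /= h i; move: (h i);
    rewrite /= !in_itv/= !mxE ltrBlDr lerBrDr.
apply: measure_box_unique => //; rewrite /= /pushforward.
  move=> a b; rewrite boxc !lebesgue_box; apply: eq_bigr => i _.
  rewrite !lebesgue_measure_itv/= !lte_fin ltrD2r; case: ifP => // _.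
  by rewrite -!EFinD; congr EFin; ring.
by move=> k; rewrite /cube boxc lebesgue_box_lty.
Qed.

(** Isolated as a predicate because it is stable under products, which reduces it to permutation and
    triangular matrices. *)
Definition scales_lebesgue n (Q : 'M[R]_n) := forall A : set 'rV[R]_n,
  measurable A -> ((`|\det Q|%R)%:E * mu ((fun v => v *m Q)%R @^-1` A) = mu A)%E.

Lemma scales_lebesgueM n (P Q : 'M[R]_n) :
  scales_lebesgue P -> scales_lebesgue Q -> scales_lebesgue (P *m Q).
Proof.
move=> hP hQ A mA; rewrite det_mulmx normrM mulrC EFinM -muleA.
rewrite -[RHS]hQ//; congr (_ * _)%E.
rewrite -[RHS]hP; last exact: measurable_preimage_mulmx.
congr (_ * mu _)%E; apply/funext => v /=.
by rewrite mulmxA.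
Qed.

(** The preimage of a box is the box with permuted sides, whose product of lengths is merely
    reordered. *)
Lemma scales_lebesgue_perm n (s : 'S_n) : scales_lebesgue (perm_mx s : 'M[R]_n).
Proof.
move=> A mA; rewrite det_perm normrX normrN1 expr1n mul1e.
have mf := @measurable_mulmx n n (perm_mx s).
have -> : mu ((fun v => v *m perm_mx s) @^-1` A) = image_measure mu mf A by [].
have boxs a b : (fun v => v *m perm_mx s) @^-1` box a b =
    box (fun i => a (s i)) (fun i => b (s i)).
  apply/seteqP; split => v /= h i.
    by have := h (s i); rewrite -{1}[s]invgK -col_permE mxE permK.
  by rewrite -[s]invgK -col_permE mxE; have := h ((s^-1)%g i); rewrite permKV.
apply: measure_box_unique => //; rewrite /= /pushforward.
  move=> a b; rewrite boxs !lebesgue_box.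
  by rewrite [RHS](reindex_inj (@perm_inj _ s)).
by move=> k; rewrite /cube boxs lebesgue_box_lty.
Qed.

(** Slices along the first coordinate are measured innermost: with the other coordinates fixed, a
    lower triangular matrix acts on that one by an affine map of the line. Uniqueness of the product
    measure allows this order. *)
Lemma lebesgue_cons_ysection n (A : set 'rV[R]_n.+1) : measurable A ->
  lebesgue_rV R n.+1 A = (\int[lebesgue_rV R n]_w
    lambda [set x | A (cons_rV (x, w))])%E.
Proof.
move=> mA.
have mcA : measurable (@cons_rV R n @^-1` A).
  by rewrite -[_ @^-1` _]setTI; exact: measurable_cons_rV.
transitivity ((lambda \x^ lebesgue_rV R n) (@cons_rV R n @^-1` A))%E.
  apply: product_measure_unique => // B C mB mC.
  by rewrite /= product_measure2E.
rewrite /= /product_measure2; apply: eq_integral => w _ /=.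
by congr (lambda _); apply/funext => x; rewrite /= /ysection/= inE.
Qed.

(** Induction on the dimension through [mulL]: for fixed [w] the first coordinate undergoes x |-> p
    x + q(w), whose shift does not affect the length of a slice, so each slice contributes |p|^-1;
    what remains is the substitution w |-> w L' in one dimension less. *)
Lemma scales_lebesgue_lower n (L : 'M[R]_n) :
  is_trig_mx L -> \det L != 0 -> scales_lebesgue L.
Proof.
elim: n L => [|n IHn] L /[dup] trL /is_trig_mxP tL detL A mA.
  rewrite det_mx00 normr1 mul1e; congr (mu _); apply/funext => v /=.
  by rewrite thinmx0 [v in RHS]thinmx0.
pose L' : 'M[R]_n := \matrix_(i, j) L (lift ord0 i) (lift ord0 j).
have trL' : is_trig_mx L'.
  by apply/is_trig_mxP => i j ij; rewrite mxE tL.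
pose p := L ord0 ord0.
have detE : \det L = p * \det L'.
  rewrite !det_trig// big_ord_recl; congr (_ * _).
  by apply: eq_bigr => i _; rewrite mxE.
move: detL; rewrite detE mulf_eq0 negb_or => /andP[p0 detL'].
pose q (w : 'rV[R]_n) : R := \sum_j w ord0 j * L (lift ord0 j) ord0.
have mulL x w : cons_rV (x, w) *m L = cons_rV (p * x + q w, w *m L').
  apply/rowP => j; rewrite mxE big_ord_recl cons_rV0/=.
  under eq_bigr do rewrite cons_rVS/=.
  case: (unliftP ord0 j) => [k|] ->.
    rewrite tL// mulr0 add0r cons_rVS mxE/=.
    by apply: eq_bigr => i _; rewrite mxE.
  by rewrite cons_rV0 mulrC.
pose G (w : 'rV[measurableTypeR R]_n) := lambda [set x | A (cons_rV (x, w))].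
have mcA : measurable (@cons_rV R n @^-1` A).
  by rewrite -[_ @^-1` _]setTI; exact: measurable_cons_rV.
have mslice w : measurable [set x : measurableTypeR R | A (cons_rV (x, w))].
  have := measurable_ysection w mcA.
  by congr measurable; apply/funext => x; rewrite /= /ysection/= inE.
have mG : measurable_fun setT G.
  rewrite (_ : G = lambda \o ysection (@cons_rV R n @^-1` A)).
    exact: measurable_fun_ysection.
  apply/funext => w; congr (lambda _).
  by apply/funext => x; rewrite /= /ysection/= inE.
rewrite !lebesgue_cons_ysection//; last exact: measurable_preimage_mulmx.
have -> : (\int[mu]_w lambda [set x | ((fun v => v *m L)%R @^-1` A)
    (cons_rV (x, w))] = \int[mu]_w ((`|p|^-1)%R%:E * G (w *m L')))%E.
  apply: eq_integral => w _.
  have := lebesgue_measure_affine (q w) p0 (mslice (w *m L')).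
  rewrite /G => <-; rewrite muleA -EFinM mulVf ?normr_eq0// mul1e.
  by congr (lambda _); apply/funext => x /=; rewrite mulL.
have mGL : measurable_fun setT (fun w : 'rV[R]_n => G (w *m L')).
  exact: (measurableT_comp mG (measurable_mulmx L')).
rewrite ge0_integralZl//.
rewrite normrM mulrC EFinM muleA -(muleA _ _ (`|p|^-1)%:E) -EFinM.
rewrite mulfV ?normr_eq0// mulr1.
(* The induction hypothesis speaks of sets, so the substitution is first moved from the integrand to
   an image measure. *)
have -> : (\int[mu]_w G (w *m L') =
    \int[pushforward mu (fun w : 'rV[R]_n => w *m L')]_w G w)%E.
  by rewrite ge0_integral_pushforward//; exact: measurable_mulmx.
have mf := @measurable_mulmx n n L'.
pose np := NngNum (normr_ge0 (\det L')).
rewrite -(ge0_integral_mscale (image_measure mu mf) measurableT np)//.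
by apply: eq_measure_integral => B mB _; exact: (IHn L' trL' detL' B mB).
Qed.

(* LUP decomposition: conjugating the upper triangular factor by the
   order-reversing permutation makes it lower triangular. *)
Lemma scales_lebesgue_unit n (Q : 'M[R]_n) : Q \in unitmx -> scales_lebesgue Q.
Proof.
case: n Q => [|n] Q uQ.
  by apply: scales_lebesgue_lower; rewrite ?det_mx00 ?oner_neq0//;
    apply/is_trig_mxP => -[].
have := cormen_lup_correct Q; have := cormen_lup_perm Q.
have := cormen_lup_lower Q; have := cormen_lup_upper Q.
have := cormen_lup_detL Q.
case: (cormen_lup Q) => -[P L] U /= detL upU loL /is_perm_mxP[s ->].
move=> E0; have {E0} E : perm_mx s *m Q = L *m U := E0.
have uU : \det U != 0.
  have := congr1 (fun M => \det M) E.
  rewrite !det_mulmx detL mul1r => <-.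
  by rewrite mulf_neq0// -unitfE// -unitmxE// unitmx_perm.
have -> : Q = perm_mx s^-1 *m L *m U.
  by rewrite -mulmxA -E mulmxA -perm_mxM mulVg perm_mx1 mul1mx.
apply: scales_lebesgueM; last first.
  pose w : 'S_n.+1 := perm (@rev_ord_inj n.+1).
  have ww : perm_mx w *m perm_mx w = 1%:M :> 'M[R]_n.+1.
    rewrite -perm_mxM (_ : (w * w)%g = 1%g) ?perm_mx1//.
    by apply/permP => i; rewrite permM !permE rev_ordK.
  have -> : U = perm_mx w *m (perm_mx w *m U *m perm_mx w) *m perm_mx w.
    by rewrite !mulmxA ww mul1mx -mulmxA ww mulmx1.
  apply: scales_lebesgueM; last exact: scales_lebesgue_perm.
  apply: scales_lebesgueM; first exact: scales_lebesgue_perm.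
  apply: scales_lebesgue_lower.
    apply/is_trig_mxP => i j ij; rewrite -row_permE -[w in _ *m perm_mx w]invgK.
    rewrite -col_permE !mxE; apply: upU.
    have -> : (w^-1)%g = w.
      by apply/permP => k; apply: (@perm_inj _ w); rewrite permKV !permE rev_ordK.
    rewrite !permE /=; have := ltn_ord i; have := ltn_ord j; move: ij.
    lia.
  rewrite !det_mulmx !det_perm !mulf_neq0// signr_eq0//.
apply: scales_lebesgueM; first exact: scales_lebesgue_perm.
apply: scales_lebesgue_lower; last by rewrite detL oner_neq0.
by apply/is_trig_mxP => i j ij; rewrite loL ?(ltnW ij)// -val_eqE/= (ltn_eqF ij).
Qed.

Lemma lebesgue_rV_affine n (Q : 'M[R]_n) (c : 'rV[R]_n) (A : set 'rV[R]_n) :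
  Q \in unitmx -> measurable A ->
  ((`|\det Q|%R)%:E * mu ((fun v => v *m Q + c)%R @^-1` A) = mu A)%E.
Proof.
move=> uQ mA; rewrite -[RHS](lebesgue_rV_translation c)//.
rewrite -[RHS](scales_lebesgue_unit uQ)//.
have := measurable_affine 1%:M c; under eq_fun do rewrite mulmx1.
by move=> /(_ measurableT _ mA); rewrite setTI.
Qed.

End affine_change.

(** * Integration of complex-valued functions *)

Section complex_parts.
Context {R : realType}.
Implicit Types z w : R[i].
Local Notation Re := complex.Re.
Local Notation Im := complex.Im.

(* The l1 norm, which avoids square roots and is submultiplicative too. *)
Definition norm1 z : R := `|Re z| + `|Im z|.

Lemma complexP z w : Re z = Re w -> Im z = Im w -> z = w.
Proof. by case: z w => [a b] [c d] /= -> ->. Qed.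

Lemma Re_mul z w : Re (z * w) = Re z * Re w - Im z * Im w.
Proof. by case: z w => [a b] [c d]. Qed.

Lemma Im_mul z w : Im (z * w) = Re z * Im w + Im z * Re w.
Proof. by case: z w => [a b] [c d]. Qed.

Lemma norm1_ge0 z : 0 <= norm1 z.
Proof. exact: addr_ge0. Qed.

Lemma norm_Re_le z : `|Re z| <= norm1 z.
Proof. by rewrite lerDl. Qed.

Lemma norm_Im_le z : `|Im z| <= norm1 z.
Proof. by rewrite lerDr. Qed.

Lemma norm1M z w : norm1 (z * w) <= norm1 z * norm1 w.
Proof.
rewrite /norm1 Re_mul Im_mul mulrDl !mulrDr -!normrM.
have := ler_normB (Re z * Re w) (Im z * Im w).
have := ler_normD (Re z * Im w) (Im z * Re w).
lra.
Qed.

Lemma norm1_real (x : R) : norm1 x%:C = `|x|.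
Proof. by rewrite /norm1 /= normr0 addr0. Qed.

Lemma norm1_prod (I : Type) (r : seq I) (P : pred I) (F : I -> R[i]) :
  norm1 (\prod_(i <- r | P i) F i) <= \prod_(i <- r | P i) norm1 (F i).
Proof.
elim/big_rec2: _ => [|i y z _ le_zy].
  by rewrite /norm1/= normr1 normr0 addr0.
by rewrite (le_trans (norm1M _ _))// ler_wpM2l// norm1_ge0.
Qed.

Lemma expiD (x y : R) : expi (x + y) = expi x * expi y.
Proof.
apply: complexP; rewrite /expi ?Re_mul ?Im_mul/= ?cosD ?sinD//.
by rewrite addrC.
Qed.

Lemma expi0 : expi (0 : R) = 1.
Proof. by rewrite /expi cos0 sin0. Qed.

Lemma expi_sum (I : Type) (r : seq I) (P : pred I) (F : I -> R) :
  expi (\sum_(i <- r | P i) F i) = \prod_(i <- r | P i) expi (F i).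
Proof. exact: (big_morph _ expiD expi0). Qed.

Lemma norm1_expi (x : R) : norm1 (expi x) <= 2.
Proof.
rewrite /norm1 /expi/= -[leRHS]/(1 + 1 :> R) lerD// ler_norml.
  by rewrite cos_geN1 cos_le1.
by rewrite sin_geN1 sin_le1.
Qed.

(** Convergence by real and imaginary parts, matching the definition of [cintegral]. *)
Definition cconverges (u : nat -> R[i]) (l : R[i]) :=
  (Re (u n) @[n --> \oo] --> Re l) /\ (Im (u n) @[n --> \oo] --> Im l).

Lemma cconverges_unique u l1 l2 :
  cconverges u l1 -> cconverges u l2 -> l1 = l2.
Proof.
move=> [r1 i1] [r2 i2]; apply: complexP.
  exact: (cvg_unique (@Rhausdorff R) r1 r2).
exact: (cvg_unique (@Rhausdorff R) i1 i2).
Qed.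

Lemma cconverges_cst l : cconverges (fun=> l) l.
Proof. by split; exact: cvg_cst. Qed.

Lemma cconvergesM u v l m :
  cconverges u l -> cconverges v m -> cconverges (fun n => u n * v n) (l * m).
Proof.
move=> [ru iu] [rv iv]; split.
  under eq_cvg do rewrite Re_mul; rewrite Re_mul.
  by apply: cvgB; exact: cvgM.
under eq_cvg do rewrite Im_mul; rewrite Im_mul.
by apply: cvgD; exact: cvgM.
Qed.

Lemma cconverges_prod (I : Type) (r : seq I) (u : I -> nat -> R[i])
    (l : I -> R[i]) : (forall i, cconverges (u i) (l i)) ->
  cconverges (fun n => \prod_(i <- r) u i n) (\prod_(i <- r) l i).
Proof.
move=> h; elim: r => [|i r IHr].
  rewrite big_nil (_ : (fun n => _) = fun=> 1); first exact: cconverges_cst.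
  by apply/funext => n; rewrite big_nil.
rewrite big_cons (_ : (fun n => _) = fun n => u i n * \prod_(j <- r) u j n).
  exact: cconvergesM.
by apply/funext => n; rewrite big_cons.
Qed.

Lemma cconverges_real (u : nat -> R) (l : R) :
  u n @[n --> \oo] --> l -> cconverges (fun n => (u n)%:C) l%:C.
Proof. by move=> h; split => //=; exact: cvg_cst. Qed.

End complex_parts.

Section cmeasurable.
Context d (T : measurableType d) (R : realType).
Local Notation Re := complex.Re.
Local Notation Im := complex.Im.
Implicit Types f g : T -> R[i].

Definition cmeasurable f :=
  measurable_fun setT (fun x => Re (f x)) /\
  measurable_fun setT (fun x => Im (f x)).

Lemma cmeasurableM f g :
  cmeasurable f -> cmeasurable g -> cmeasurable (fun x => f x * g x).
Proof.
move=> [rf jf] [rg jg]; split.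
  under eq_fun do rewrite Re_mul.
  by apply: measurable_funB; exact: measurable_funM.
under eq_fun do rewrite Im_mul.
by apply: measurable_funD; exact: measurable_funM.
Qed.

Lemma cmeasurable_cst (c : R[i]) : cmeasurable (fun=> c).
Proof. by split; exact: measurable_cst. Qed.

Lemma cmeasurable_real (u : T -> R) :
  measurable_fun setT u -> cmeasurable (fun x => (u x)%:C).
Proof. by move=> mu; split => //=; exact: measurable_cst. Qed.

Lemma cmeasurable_expi (u : T -> R) :
  measurable_fun setT u -> cmeasurable (fun x => expi (u x)).
Proof.
move=> mu; split => /=.
  apply: (measurableT_comp (f := @cos R)) => //.
  by apply: continuous_measurable_fun; exact: continuous_cos.
apply: (measurableT_comp (f := @sin R)) => //.
by apply: continuous_measurable_fun; exact: continuous_sin.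
Qed.

Lemma cmeasurable_prod (I : Type) (r : seq I) (F : I -> T -> R[i]) :
  (forall i, cmeasurable (F i)) -> cmeasurable (fun x => \prod_(i <- r) F i x).
Proof.
move=> mF; elim: r => [|i r IHr].
  by under eq_fun do rewrite big_nil; exact: cmeasurable_cst.
under eq_fun do rewrite big_cons.
exact: cmeasurableM.
Qed.

Lemma measurable_norm1 f :
  cmeasurable f -> measurable_fun setT (fun x => norm1 (f x)).
Proof.
by move=> [rf jf]; apply: measurable_funD; exact: measurableT_comp.
Qed.

End cmeasurable.

Lemma cmeasurable_comp d d' (T : measurableType d) (T' : measurableType d')
    (R : realType) (f : T' -> R[i]) (h : T -> T') :
  measurable_fun setT h -> cmeasurable f -> cmeasurable (fun x => f (h x)).
Proof.
move=> mh [rf jf]; split.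
  exact: (measurableT_comp rf mh).
exact: (measurableT_comp jf mh).
Qed.

Section cintegral_theory.
Context d (T : measurableType d) (R : realType).
Variable mu : {measure set T -> \bar R}.
Local Notation Re := complex.Re.
Local Notation Im := complex.Im.
Implicit Types f g : T -> R[i].

Lemma cintegrable_measurable f : cintegrable mu f -> cmeasurable f.
Proof.
by move=> [/measurable_int/measurable_EFinP ? /measurable_int/measurable_EFinP].
Qed.

Lemma cintegrable_norm1 f :
  cintegrable mu f -> mu.-integrable setT (fun x => (norm1 (f x))%:E).
Proof.
move=> [/integrable_norm rf /integrable_norm jf].
exact: (integrableD measurableT rf jf).
Qed.

Lemma le_cintegrable f (g : T -> R) : cmeasurable f ->
  (forall x, norm1 (f x) <= g x) -> mu.-integrable setT (EFin \o g) ->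
  cintegrable mu f.
Proof.
move=> [rf jf] fg ig.
have g0 x : 0 <= g x by rewrite (le_trans _ (fg x))// norm1_ge0.
split; apply: le_integrable ig => //;
  do 1?[exact/measurable_EFinP]; move=> x _ /=; rewrite lee_fin (ger0_norm (g0 x)).
  exact: le_trans (norm_Re_le _) (fg x).
exact: le_trans (norm_Im_le _) (fg x).
Qed.

Lemma cintegrable_lty f : cmeasurable f ->
  (\int[mu]_x (norm1 (f x))%:E < +oo)%E -> cintegrable mu f.
Proof.
move=> mf foo; apply: (@le_cintegrable f (fun x => norm1 (f x))) => //.
apply/integrableP; split; first exact/measurable_EFinP/measurable_norm1.
apply: le_lt_trans foo; apply: ge0_le_integral => //.
- by apply/measurable_EFinP; apply: measurableT_comp => //; exact: measurable_norm1.
- exact/measurable_EFinP/measurable_norm1.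
- by move=> x _ /=; rewrite lee_fin ger0_norm// norm1_ge0.
Qed.

Lemma cintegrableMr f g (C : R) : cintegrable mu f -> cmeasurable g ->
  (forall x, norm1 (g x) <= C) -> cintegrable mu (fun x => f x * g x).
Proof.
move=> cf mg gC.
apply: (@le_cintegrable _ (fun x => C * norm1 (f x))).
- by apply: cmeasurableM => //; exact: cintegrable_measurable.
- move=> x; apply: le_trans (norm1M _ _) _.
  by rewrite mulrC ler_wpM2r ?norm1_ge0.
- have := integrableZl measurableT C (cintegrable_norm1 cf).
  by apply: (eq_integrable measurableT) => x _; rewrite /= EFinM.
Qed.

Lemma cintegrableZl (c : R[i]) f :
  cintegrable mu f -> cintegrable mu (fun x => c * f x).
Proof.
move=> cf; under eq_fun do rewrite mulrC.
by apply: (cintegrableMr (C := norm1 c)).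
Qed.

Lemma cintegrable_expi f (u : T -> R) : cintegrable mu f ->
  measurable_fun setT u -> cintegrable mu (fun x => f x * expi (u x)).
Proof.
move=> cf mu'; apply: (cintegrableMr (C := 2)) => //.
  exact: cmeasurable_expi.
by move=> x; exact: norm1_expi.
Qed.

Lemma eq_cintegral f g : f =1 g -> cintegral mu f = cintegral mu g.
Proof. by move=> fg; congr cintegral; exact/funext. Qed.

Lemma cintegralZl (c : R[i]) f :
  cintegrable mu f -> cintegral mu (fun x => c * f x) = c * cintegral mu f.
Proof.
move=> [rf jf].
have Zl (k : R) (h : T -> R) : mu.-integrable setT (EFin \o h) ->
    mu.-integrable setT (EFin \o (fun x => k * h x)).
  by move=> /(integrableZl measurableT k).
apply: complexP; rewrite ?Re_mul ?Im_mul /=.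
  under eq_Rintegral do rewrite Re_mul.
  by rewrite RintegralB ?RintegralZl//; exact: Zl.
under eq_Rintegral do rewrite Im_mul.
by rewrite RintegralD ?RintegralZl//; exact: Zl.
Qed.

Lemma cintegralZr (c : R[i]) f :
  cintegrable mu f -> cintegral mu (fun x => f x * c) = cintegral mu f * c.
Proof.
by move=> cf; rewrite mulrC -cintegralZl//; apply: eq_cintegral => x; rewrite mulrC.
Qed.

Lemma cdominated_convergence (f_ : nat -> T -> R[i]) f (g : T -> R) :
  (forall n, cmeasurable (f_ n)) -> cmeasurable f ->
  {ae mu, forall x, cconverges (f_ ^~ x) (f x)} ->
  mu.-integrable setT (EFin \o g) ->
  (forall n x, norm1 (f_ n x) <= g x) ->
  cconverges (fun n => cintegral mu (f_ n)) (cintegral mu f).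
Proof.
move=> mf_ [rf jf] cvf ig fg.
have cvg_fine (h_ : nat -> T -> R) (h : T -> R) :
    (forall n, measurable_fun setT (h_ n)) -> measurable_fun setT h ->
    {ae mu, forall x, h_ n x @[n --> \oo] --> h x} ->
    (forall n x, `|h_ n x| <= g x) ->
    (\int[mu]_x h_ n x)%R @[n --> \oo] --> (\int[mu]_x h x)%R.
  move=> mh_ mh cvh hg.
  have cvh' : {ae mu, forall x, setT x ->
      (h_ n x)%:E @[n --> \oo] --> (h x)%:E}.
    by apply: filterS cvh => x hx _; apply: cvg_EFin => //; exact: nearW.
  have hg' : {ae mu, forall x n, setT x -> (`|(h_ n x)%:E| <= (EFin \o g) x)%E}.
    by apply: aeW => x n _; rewrite /= lee_fin.
  have [ih _ cvI] := @dominated_convergence _ _ _ mu setT measurableT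
    (fun n x => (h_ n x)%:E) (fun x => (h x)%:E) (EFin \o g)
    (fun n => (measurable_EFinP _ _).2 (mh_ n)) ((measurable_EFinP _ _).2 mh)
    cvh' ig hg'.
  apply: fine_cvg; rewrite fineK//; exact: integrable_fin_num.
split.
  apply: cvg_fine => //.
  - by move=> n; exact: (mf_ n).1.
  - by apply: filterS cvf => x [].
  - by move=> n x; exact: le_trans (norm_Re_le _) (fg n x).
apply: cvg_fine => //.
- by move=> n; exact: (mf_ n).2.
- by apply: filterS cvf => x [].
- by move=> n x; exact: le_trans (norm_Im_le _) (fg n x).
Qed.

End cintegral_theory.

(** * Fubini's theorem and tensor products for complex integrands *)

Section cfubini.
Context d1 d2 (T1 : measurableType d1) (T2 : measurableType d2) (R : realType).
Variables (m1 : {sigma_finite_measure set T1 -> \bar R})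
          (m2 : {sigma_finite_measure set T2 -> \bar R}).
Local Notation Re := complex.Re.
Local Notation Im := complex.Im.
Implicit Types F : T1 * T2 -> R[i].

(** The inner integrals of Fubini's theorem are extended reals, whereas [cintegral] applies [fine]
    to them. Integrability makes them finite almost everywhere, so the outer integral does not see
    the difference. *)
Lemma fine_ae_eq d (T : measurableType d) (m : {measure set T -> \bar R})
    (h : T -> \bar R) : m.-integrable setT h ->
  m.-integrable setT (EFin \o (fine \o h)) /\
  (\int[m]_x (fine (h x))%:E = \int[m]_x h x)%E.
Proof.
move=> ih; have mh := measurable_int _ ih.
have mf : measurable_fun setT (EFin \o (fine \o h)).
  by apply/measurable_EFinP; apply: (measurableT_comp (f := fine)).
split.
  apply: le_integrable ih => // x _ /=.
  by case: (h x) => //=; rewrite normr0 leey.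
apply: ae_eq_integral => //.
by apply: filterS (integrable_ae measurableT ih) => x + _ => /(_ I)/fineK ->.
Qed.

Lemma cfubini1 F : cintegrable (m1 \x m2)%E F ->
  cintegrable m1 (fun x => cintegral m2 (fun y => F (x, y))) /\
  cintegral m1 (fun x => cintegral m2 (fun y => F (x, y))) =
  cintegral (m1 \x m2)%E F.
Proof.
move=> [rF jF].
have [ir er] := fine_ae_eq (integrable_fubini_F rF).
have [ij ej] := fine_ae_eq (integrable_fubini_F jF).
split; first by split.
apply: complexP => /=; congr fine.
  by rewrite -[RHS](integral12_prod_meas1 rF).
by rewrite -[RHS](integral12_prod_meas1 jF).
Qed.

Lemma cfubini2 F : cintegrable (m1 \x m2)%E F ->
  cintegrable m2 (fun y => cintegral m1 (fun x => F (x, y))) /\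
  cintegral m2 (fun y => cintegral m1 (fun x => F (x, y))) =
  cintegral (m1 \x m2)%E F.
Proof.
move=> [rF jF].
have integrable_fubini_G (h : T1 * T2 -> \bar R) :
    (m1 \x m2)%E.-integrable setT h -> m2.-integrable setT (fubini_G m1 h).
  move=> ih; apply/integrableP; split; first exact: measurable_fubini_G ih.
  apply: le_lt_trans ((integrable21ltyP _ _ (measurable_int _ ih)).1 ih).
  apply: ge0_le_integral => //.
  - by apply: measurableT_comp => //; exact: measurable_fubini_G ih.
  - apply: (measurable_fun_fubini_tonelli_G (abse \o h)) => //=.
    by apply: measurableT_comp => //; exact: measurable_int ih.
  - move=> y _; apply: le_abse_integral => //.
    by apply: measurableT_comp => //; exact: measurable_int ih.
have [ir er] := fine_ae_eq (integrable_fubini_G _ rF).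
have [ij ej] := fine_ae_eq (integrable_fubini_G _ jF).
split; first by split.
apply: complexP => /=; congr fine.
  by rewrite -[RHS](integral21_prod_meas1 rF).
by rewrite -[RHS](integral21_prod_meas1 jF).
Qed.

Lemma cfubini F : cintegrable (m1 \x m2)%E F ->
  cintegral m1 (fun x => cintegral m2 (fun y => F (x, y))) =
  cintegral m2 (fun y => cintegral m1 (fun x => F (x, y))).
Proof. by move=> iF; rewrite (cfubini1 iF).2 (cfubini2 iF).2. Qed.

Lemma ae_cintegrable2 F : cintegrable (m1 \x m2)%E F ->
  {ae m2, forall y, cintegrable m1 (fun x => F (x, y))}.
Proof.
move=> [rF jF]; have ir := ae_integrable2 rF; have ij := ae_integrable2 jF.
by apply: filterS2 ir ij.
Qed.

Lemma cmeasurable_fst (f : T1 -> R[i]) :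
  cmeasurable f -> cmeasurable (fun p : T1 * T2 => f p.1).
Proof. exact: cmeasurable_comp. Qed.

Lemma cmeasurable_snd (f : T2 -> R[i]) :
  cmeasurable f -> cmeasurable (fun p : T1 * T2 => f p.2).
Proof. exact: cmeasurable_comp. Qed.

Lemma cintegrable_tensor (f : T1 -> R[i]) (g : T2 -> R[i]) :
  cintegrable m1 f -> cintegrable m2 g ->
  cintegrable (m1 \x m2)%E (fun p => f p.1 * g p.2).
Proof.
move=> cf cg.
have mf := cintegrable_measurable cf; have mg := cintegrable_measurable cg.
have if1 := cintegrable_norm1 cf; have ig1 := cintegrable_norm1 cg.
have mF : cmeasurable (fun p : T1 * T2 => f p.1 * g p.2).
  by apply: cmeasurableM; [exact: cmeasurable_fst|exact: cmeasurable_snd].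
have mN : measurable_fun setT
    (fun p : T1 * T2 => ((norm1 (f p.1) * norm1 (g p.2))%:E)).
  apply/measurable_EFinP; apply: measurable_funM.
    exact: (measurableT_comp (measurable_norm1 mf) measurable_fst).
  exact: (measurableT_comp (measurable_norm1 mg) measurable_snd).
apply: cintegrable_lty => //.
(* [norm1] is only submultiplicative, so the majorant is the product of the two norms, whose Tonelli
   integral factors. *)
apply: (@le_lt_trans _ _
    (\int[m1 \x m2]_p (norm1 (f p.1) * norm1 (g p.2))%:E)%E).
  apply: ge0_le_integral => //.
  - by move=> p _; rewrite lee_fin norm1_ge0.
  - exact/measurable_EFinP/measurable_norm1.
  - by move=> p _; rewrite lee_fin norm1M.
rewrite fubini_tonelli1//; last first.
  by move=> p; rewrite lee_fin mulr_ge0// norm1_ge0.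
rewrite /fubini_F/=.
under eq_integral => x _.
  under eq_integral do rewrite EFinM.
  rewrite ge0_integralZl//; last 3 first.
  - exact/measurable_EFinP/measurable_norm1.
  - by move=> y _; rewrite lee_fin norm1_ge0.
  - by rewrite lee_fin norm1_ge0.
  over.
rewrite ge0_integralZr//; last 3 first.
- exact/measurable_EFinP/measurable_norm1.
- by move=> x _; rewrite lee_fin norm1_ge0.
- by apply: integral_ge0 => y _; rewrite lee_fin norm1_ge0.
apply: lte_mul_pinfty.
- by apply: integral_ge0 => y _; rewrite lee_fin norm1_ge0.
- exact: integrable_fin_num.
- exact: integrable_lty.
Qed.

Lemma cintegral_tensor (f : T1 -> R[i]) (g : T2 -> R[i]) :
  cintegrable m1 f -> cintegrable m2 g ->
  cintegral (m1 \x m2)%E (fun p => f p.1 * g p.2) =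
  cintegral m1 f * cintegral m2 g.
Proof.
move=> cf cg; rewrite -(cfubini1 (cintegrable_tensor cf cg)).2/=.
under eq_cintegral do rewrite cintegralZl//.
by rewrite cintegralZr.
Qed.

End cfubini.

Section cpushforward.
Context d d' (T : measurableType d) (T' : measurableType d') (R : realType).
Variable mu : {measure set T -> \bar R}.
Variables (phi : T -> T') (mphi : measurable_fun setT phi).
Implicit Types f : T' -> R[i].

Lemma cintegral_image f : cintegrable mu (f \o phi) -> cmeasurable f ->
  cintegrable (image_measure mu mphi) f /\
  cintegral (image_measure mu mphi) f = cintegral mu (f \o phi).
Proof.
move=> [rf jf] [mrf mjf].
have {}mrf := (measurable_EFinP _ _).2 mrf.
have {}mjf := (measurable_EFinP _ _).2 mjf.
split; first by split; exact: integrable_pushforward.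
apply: complexP; congr fine.
  by rewrite (integral_pushforward mphi mrf).
by rewrite (integral_pushforward mphi mjf).
Qed.

End cpushforward.

Lemma ae_eq_cintegral d (T : measurableType d) (R : realType)
    (mu : {measure set T -> \bar R}) (f g : T -> R[i]) :
  cmeasurable f -> cmeasurable g -> {ae mu, forall x, f x = g x} ->
  cintegral mu f = cintegral mu g.
Proof.
move=> [rf jf] [rg jg] fg; apply: complexP; congr fine;
  apply: ae_eq_integral => //; try exact/measurable_EFinP;
  by apply: filterS fg => x ->.
Qed.

(** * Affine substitution under the integral *)

Section affine_integral.
Context {R : realType} {n : nat}.
Local Notation mu := (lebesgue_rV R n).
Implicit Types (Q : 'M[R]_n) (c : 'rV[R]_n) (f : 'rV[R]_n -> R[i]).

(** By [lebesgue_rV_affine], [mu] is |det Q| times its own image under v |-> v Q + c, so the formula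
    is that of integration against an image measure. *)
Lemma ge0_integral_affine Q c (h : 'rV[R]_n -> \bar R) : Q \in unitmx ->
  measurable_fun setT (h : 'rV[measurableTypeR R]_n -> \bar R) ->
  (forall v, 0 <= h v)%E ->
  (`|\det Q|%:E * \int[mu]_v h (v *m Q + c)%R = \int[mu]_v h v)%E.
Proof.
move=> uQ mh h0.
rewrite -(ge0_integral_pushforward (measurable_affine Q c) mu measurableT mh)//.
pose np := NngNum (normr_ge0 (\det Q)).
rewrite -(ge0_integral_mscale (image_measure mu (measurable_affine Q c))
  measurableT np)//.
by apply: eq_measure_integral => A mA _; exact: (lebesgue_rV_affine c uQ mA).
Qed.

Lemma integral_affine Q c (h : 'rV[R]_n -> R) : Q \in unitmx ->
  mu.-integrable setT (EFin \o h) ->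
  mu.-integrable setT (fun v => (h (v *m Q + c))%:E) /\
  `|\det Q| * (\int[mu]_v h (v *m Q + c)%R)%R = (\int[mu]_v h v)%R.
Proof.
move=> uQ ih.
have mh := measurable_int _ ih.
have maff := measurable_affine Q c.
have mha : measurable_fun setT (fun v : 'rV[R]_n => (h (v *m Q + c))%:E).
  exact: (measurableT_comp mh maff).
have dQ : 0 < `|\det Q| by rewrite normr_gt0 -unitfE -unitmxE.
have iha : mu.-integrable setT (fun v => (h (v *m Q + c))%:E).
  apply/integrableP; split=> //.
  move/integrableP : ih => [_].
  rewrite -(ge0_integral_affine c uQ) => [|//|//]; last exact: measurableT_comp.
  case: (\int[mu]_v _)%E => //=; first by move=> *; rewrite ltry.
  by rewrite mulry gtr0_sg// mul1e.
split=> //.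
rewrite /Rintegral -[`|_|]/(fine `|\det Q|%:E) -fineM//; last first.
  exact: integrable_fin_num.
congr fine; rewrite integralE [RHS]integralE muleBr//; last first.
  by apply: fin_num_adde_defl; rewrite fin_numN; exact: integrable_neg_fin_num.
congr (_ - _)%E.
  rewrite -[RHS](ge0_integral_affine c uQ)//; last exact: measurable_funepos.
  by congr (_ * _)%E; apply: eq_integral => v _; rewrite !funeposE.
rewrite -[RHS](ge0_integral_affine c uQ)//; last exact: measurable_funeneg.
by congr (_ * _)%E; apply: eq_integral => v _; rewrite !funenegE.
Qed.

Lemma cintegral_affine Q c f : Q \in unitmx -> cintegrable mu f ->
  cintegrable mu (fun v => f (v *m Q + c)) /\
  (`|\det Q|)%:C * cintegral mu (fun v => f (v *m Q + c)) = cintegral mu f.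
Proof.
move=> uQ [rf jf].
have [ir er] := integral_affine c uQ rf.
have [ij ej] := integral_affine c uQ jf.
split; first by split.
apply: complexP; rewrite ?Re_mul ?Im_mul/= mul0r ?subr0 ?addr0.
  by rewrite -er.
by rewrite -ej.
Qed.

End affine_integral.

(** * Integrals of products over coordinates *)

Section rV_tensor.
Context {R : realType}.
Local Notation lambda := (@lebesgue_measure R).

Lemma cintegral_cons n (F : 'rV[R]_n.+1 -> R[i]) :
  cmeasurable (F : 'rV[measurableTypeR R]_n.+1 -> R[i]) ->
  cintegrable (lambda \x lebesgue_rV R n)%E (F \o @cons_rV R n) ->
  cintegrable (lebesgue_rV R n.+1) F /\
  cintegral (lebesgue_rV R n.+1) F =
  cintegral (lambda \x lebesgue_rV R n)%E (F \o @cons_rV R n).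
Proof.
move=> mF iF.
have [i e] := cintegral_image (@measurable_cons_rV R n) iF mF.
by split.
Qed.

Lemma cintegral_prod n (phi : 'I_n -> measurableTypeR R -> R[i]) :
  (forall i, cintegrable lambda (phi i)) ->
  cintegrable (lebesgue_rV R n) (fun v => \prod_i phi i (v ord0 i)) /\
  cintegral (lebesgue_rV R n) (fun v => \prod_i phi i (v ord0 i)) =
  \prod_i cintegral lambda (phi i).
Proof.
elim: n phi => [|n IHn] phi cphi.
  (* In dimension 0 the measure is the Dirac mass at the only vector, and the empty product
     integrates to 1. *)
  under eq_fun do rewrite big_ord0.
  rewrite big_ord0.
  split; last first.
    apply: complexP; rewrite /= /Rintegral.
      by rewrite integral_dirac//= indicT mulr1.
    by rewrite integral0.
  apply: cintegrable_lty; first exact: cmeasurable_cst.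
  by rewrite /= integral_dirac//= diracT mul1e ltry.
have [ih eh] := IHn (fun i => phi (lift ord0 i)) (fun i => cphi _).
have E : (fun v : 'rV[R]_n.+1 => \prod_i phi i (v ord0 i)) \o @cons_rV R n =
    fun p => phi ord0 p.1 * \prod_i phi (lift ord0 i) (p.2 ord0 i).
  apply/funext => p /=; rewrite big_ord_recl cons_rV0; congr (_ * _).
  by apply: eq_bigr => i _; rewrite cons_rVS.
have := @cintegral_cons n (fun v : 'rV[R]_n.+1 => \prod_i phi i (v ord0 i)).
rewrite E => -[||i ->].
- apply: cmeasurable_prod => i.
  have mi := @measurable_coord_rV _ (measurableTypeR R) n.+1 i.
  exact: (cmeasurable_comp mi (cintegrable_measurable (cphi i))).
- exact: (cintegrable_tensor (cphi ord0) ih).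
- by rewrite (cintegral_tensor (cphi ord0) ih) eh big_ord_recl.
Qed.

End rV_tensor.

(** * The Fourier transform of the Laplace kernel *)

Section poisson_kernel.
Context {R : realType}.
Local Notation lambda := (@lebesgue_measure R).
Implicit Types e k x : R.

Definition damp e x : R := expR (- (e * `|x|)).

Lemma damp_gt0 e x : 0 < damp e x.
Proof. exact: expR_gt0. Qed.

Lemma damp_le1 e x : 0 <= e -> damp e x <= 1.
Proof. by move=> e0; rewrite expR_le1 oppr_le0 mulr_ge0. Qed.

Lemma continuous_damp e : continuous (damp e).
Proof.
move=> x; apply: continuous_comp; last exact: continuous_expR.
apply: continuousN; apply: continuousM; first exact: cvg_cst.
exact: norm_continuous.
Qed.

Lemma measurable_damp e : measurable_fun setT (damp e : measurableTypeR R -> R).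
Proof. exact: (continuous_measurable_fun (@continuous_damp e)). Qed.

Lemma is_derive_mulrl k x : is_derive x (1 : R) ( *%R k) k.
Proof.
have := @is_deriveZ _ _ _ id k x 1 1 (is_derive_id x 1).
by rewrite [_ *: 1]mulr1.
Qed.

(** The real part of e^{(-e + ik)x} / (-e + ik), minus e^{-ex} / e: the primitive of e^{-ex} (1 +
    cos kx) that vanishes at +oo, so the integral over the half-line is minus its value at 0. *)
Definition damped_primitive e k x : R :=
  expR (- (e * x)) *
  ((k * sin (k * x) - e * cos (k * x)) / (e ^+ 2 + k ^+ 2) - e^-1).

Lemma is_derive_damped_primitive e k x : 0 < e ->
  is_derive x (1 : R) (damped_primitive e k)
    (expR (- (e * x)) * (1 + cos (k * x))).
Proof.
move=> e0.
have dE : is_derive x (1 : R) (fun x => expR (- (e * x)))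
    (expR (- (e * x)) * - e).
  apply: (@is_derive1_comp _ expR (fun x => - (e * x))).
  exact: (is_deriveN (is_derive_mulrl e x)).
have dS : is_derive x (1 : R) (fun x => sin (k * x)) (cos (k * x) * k).
  by apply: (@is_derive1_comp _ sin ( *%R k)); exact: is_derive_mulrl.
have dC : is_derive x (1 : R) (fun x => cos (k * x)) (- sin (k * x) * k).
  by apply: (@is_derive1_comp _ cos ( *%R k)); exact: is_derive_mulrl.
pose c := (e ^+ 2 + k ^+ 2)^-1.
have dI : is_derive x (1 : R) (fun x => (k * sin (k * x) - e * cos (k * x)) * c -
    e^-1) ((k * (cos (k * x) * k) - e * (- sin (k * x) * k)) * c).
  have d1 := @is_deriveB _ _ _ _ _ _ _ _ _ (is_deriveZ k dS) (is_deriveZ e dC).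
  have d2 := @is_deriveB _ _ _ _ _ _ _ _ _ (is_deriveZ c d1)
    (is_derive_cst e^-1 x 1).
  rewrite subr0 in d2.
  by move: d2; congr is_derive; [apply/funext => y|];
    rewrite /GRing.scale/=; rewrite mulrC.
have := is_deriveM dE dI.
congr is_derive; rewrite /GRing.scale/= /c; field.
have : 0 < e ^+ 2 + k ^+ 2 by rewrite ltr_pwDl ?exprn_gt0 ?sqr_ge0.
by move=> /lt0r_neq0 ->; rewrite gt_eqF.
Qed.

Lemma cvg_damped_primitive e k : 0 < e ->
  damped_primitive e k x @[x --> +oo] --> (0 : R).
Proof.
(* [C] bounds the trigonometric factor uniformly in x, which leaves the decay of the exponential. *)
move=> e0; pose C : R := (`|k| + e) / (e ^+ 2 + k ^+ 2) + e^-1.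
have d0 : 0 < e ^+ 2 + k ^+ 2 by rewrite ltr_pwDl ?exprn_gt0 ?sqr_ge0.
have cvgE : expR (- (e * x)) @[x --> +oo] --> (0 : R).
  apply: (@cvg_comp _ _ _ ( *%R e) (fun x => expR (- x))); last exact: cvgr_expR.
  exact: gt0_cvgMry.
apply/cvgr0Pnorm_le => /= d dgt0.
have C0 : 0 < C.
  apply: ltr_wpDl; last by rewrite invr_gt0.
  by apply: divr_ge0; [apply: addr_ge0; rewrite ?(ltW e0)|exact: ltW].
near=> x.
rewrite normrM; apply: (@le_trans _ _ (expR (- (e * x)) * C)).
  rewrite ger0_norm ?expR_ge0// ler_wpM2l ?expR_ge0//.
  apply: le_trans (ler_normB _ _) _; apply: lerD; last first.
    by rewrite gtr0_norm ?invr_gt0.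
  rewrite normrM (gtr0_norm (x := (e ^+ 2 + k ^+ 2)^-1)) ?invr_gt0//.
  apply: ler_wpM2r; first by rewrite invr_ge0 ltW.
  apply: le_trans (ler_normB _ _) _; rewrite !normrM (gtr0_norm e0).
  apply: lerD; rewrite ler_piMr ?normr_ge0 ?(ltW e0)//.
    by rewrite ler_norml sin_geN1 sin_le1.
  by rewrite ler_norml cos_geN1 cos_le1.
rewrite -ler_pdivlMr// ltW// -[ltLHS]ger0_norm ?expR_ge0//.
near: x; move/cvgr0_norm_lt : cvgE; apply.
by rewrite divr_gt0.
Unshelve. all: by end_near. Qed.

Lemma continuous_damped_cos e k :
  continuous (fun x : R => expR (- (e * x)) * (1 + cos (k * x))).
Proof.
move=> x; apply: (@continuousM _ _ (fun x => expR (- (e * x)))).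
  apply: continuous_comp; last exact: continuous_expR.
  by apply: continuousN; exact: mulrl_continuous.
apply: cvgD; first exact: cvg_cst.
apply: (@continuous_comp _ _ _ ( *%R k) cos); first exact: mulrl_continuous.
exact: continuous_cos.
Qed.

(* Adding 1 to the cosine makes the integrand nonnegative, as the fundamental
   theorem on a half-line requires. *)
Lemma integral_damped_cosy e k : 0 < e ->
  (\int[lambda]_(x in `[0%R, +oo[) (expR (- (e * x)) * (1 + cos (k * x)))%:E =
   (e^-1 + e / (e ^+ 2 + k ^+ 2))%:E)%E.
Proof.
move=> e0.
have dF x := is_derive_damped_primitive k x e0.
rewrite (@ge0_continuous_FTC2y _ _ (damped_primitive e k) 0 0).
- rewrite /damped_primitive !mulr0 sin0 cos0 oppr0 expR0 -EFinB.
  by congr EFin; ring.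
- by move=> x _; rewrite mulr_ge0 ?expR_ge0// -lerBlDl sub0r cos_geN1.
- by apply: continuous_subspaceT; exact: continuous_damped_cos.
- exact: cvg_damped_primitive.
- by move=> x _.
- apply: cvg_at_right_filter.
  by apply: differentiable_continuous; exact/derivable1_diffP.
- by move=> x _; rewrite derive1E; exact: derive_val.
Qed.

(** Evenness doubles the half-line value. At k = 0 the integrand is twice [damp e], which yields the
    integrability and the mass of [damp e]; these in turn allow the 1 to be subtracted again. *)
Lemma integral_damp_1cos e k : 0 < e ->
  lambda.-integrable setT (fun x => (damp e x * (1 + cos (k * x)))%:E) /\
  (\int[lambda]_x (damp e x * (1 + cos (k * x)))%:E =
   (2 * (e^-1 + e / (e ^+ 2 + k ^+ 2)))%:E)%E.
Proof.
move=> e0.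
have cf : continuous (fun x : R => damp e x * (1 + cos (k * x))).
  move=> x; apply: (@continuousM _ _ (damp e)); first exact: continuous_damp.
  apply: cvgD; first exact: cvg_cst.
  apply: (@continuous_comp _ _ _ ( *%R k) cos); first exact: mulrl_continuous.
  exact: continuous_cos.
have f0 x : 0 <= damp e x * (1 + cos (k * x)).
  by rewrite mulr_ge0 ?expR_ge0// -lerBlDl sub0r cos_geN1.
have E : (\int[lambda]_x (damp e x * (1 + cos (k * x)))%:E =
   (2 * (e^-1 + e / (e ^+ 2 + k ^+ 2)))%:E)%E.
  rewrite ge0_symfun_integralT//; last first.
    by move=> x /=; rewrite /damp normrN mulrN cosN.
  rewrite EFinM -integral_damped_cosy// -set_itvcy; congr (_ * _)%E.
  apply: eq_integral => x; rewrite inE/= in_itv/= andbT => x0.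
  by rewrite /damp ger0_norm.
split=> //; apply/integrableP; split.
  by apply/measurable_EFinP; exact: continuous_measurable_fun.
under eq_integral do rewrite gee0_abs ?lee_fin//.
by rewrite E ltry.
Qed.

Lemma integrable_damp e : 0 < e -> lambda.-integrable setT (EFin \o damp e).
Proof.
move=> e0; have [+ _] := integral_damp_1cos 0 e0.
move=> /(integrableZl measurableT 2^-1).
apply: (eq_integrable measurableT) => x _ /=.
by rewrite mul0r cos0 -EFinM; congr EFin; field.
Qed.

Lemma Rintegral_damp e : 0 < e -> (\int[lambda]_x damp e x)%R = 2 / e.
Proof.
move=> e0; have [i E] := integral_damp_1cos 0 e0.
have -> : (\int[lambda]_x damp e x =
    \int[lambda]_x (2^-1 * (damp e x * (1 + cos (0 * x)))))%R.
  by apply: eq_Rintegral => x _; rewrite mul0r cos0; field.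
rewrite RintegralZl//.
rewrite {1}/Rintegral E /=.
by field; rewrite gt_eqF.
Qed.

Definition poisson e k : R := 2 * e / (e ^+ 2 + k ^+ 2).

Lemma cintegrable_damp e : 0 < e -> cintegrable lambda (fun x => (damp e x)%:C).
Proof.
move=> e0; apply: (@le_cintegrable _ (measurableTypeR R) R lambda _ (damp e)).
- by apply: cmeasurable_real; exact: measurable_damp.
- by move=> x; rewrite norm1_real ger0_norm// ltW// damp_gt0.
- exact: integrable_damp.
Qed.

Lemma Rintegral_damp_cos e k : 0 < e ->
  (\int[lambda]_x (damp e x * cos (k * x)))%R = poisson e k.
Proof.
move=> e0; have [i E] := integral_damp_1cos k e0.
have -> : (\int[lambda]_x (damp e x * cos (k * x)) =
    \int[lambda]_x (damp e x * (1 + cos (k * x)) - damp e x))%R.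
  by apply: eq_Rintegral => x _; ring.
rewrite RintegralB//; last exact: integrable_damp.
rewrite Rintegral_damp// {1}/Rintegral E /= /poisson; field.
have : 0 < e ^+ 2 + k ^+ 2 by rewrite ltr_pwDl ?exprn_gt0 ?sqr_ge0.
by move=> /lt0r_neq0 ->; rewrite gt_eqF.
Qed.

Lemma Rintegral_odd (f : R -> R) :
  measurable_fun setT (f : measurableTypeR R -> R) ->
  (forall x, f (- x) = - f x) ->
  lambda.-integrable setT (EFin \o f) -> (\int[lambda]_x f x)%R = 0.
Proof.
move=> mf oddf iF.
have mN : measurable_fun setT (-%R : measurableTypeR R -> measurableTypeR R).
  exact: oppr_measurable.
have mEf := (measurable_EFinP _ _).2 mf.
have ifN : lambda.-integrable setT ((EFin \o f) \o (-%R : measurableTypeR R -> _)).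
  have := integrableN iF; apply: (eq_integrable measurableT) => x _.
  by rewrite /= oddf.
suff H : (\int[lambda]_x f x)%R = - (\int[lambda]_x f x)%R.
  by apply/eqP; rewrite -[_ == 0](mulrn_eq0 _ 2) mulr2n {1}H addNr.
transitivity (\int[lambda]_x f (- x))%R.
  have := integral_pushforward mN mEf ifN measurableT.
  rewrite preimage_setT /Rintegral => <-; congr fine.
  by apply: eq_measure_integral => A mA _; exact/esym/lebesgue_measureN.
under eq_Rintegral do rewrite oddf -mulN1r.
by rewrite RintegralZl// mulN1r.
Qed.

Lemma cintegral_damp_expi e k : 0 < e ->
  cintegral lambda (fun x => (damp e x)%:C * expi (k * x)) = (poisson e k)%:C.
Proof.
move=> e0.
have mk : measurable_fun setT ( *%R k : measurableTypeR R -> R).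
  exact: mulrl_measurable.
have [_ jf] := cintegrable_expi (cintegrable_damp e0) mk.
apply: complexP => /=.
  rewrite -Rintegral_damp_cos//; apply: eq_Rintegral => x _.
  by rewrite mul0r subr0.
apply: Rintegral_odd; last exact: jf.
  by have /measurable_EFinP := measurable_int _ jf.
move=> x; rewrite !mul0r !addr0 mulrN sinN /damp normrN.
by rewrite mulrN.
Qed.

End poisson_kernel.

(** * Damped transforms of intervals and smoothed indicators *)

Section test_function.
Context {R : realType}.
Local Notation lambda := (@lebesgue_measure R).
Implicit Types e a b t w y : R.

Definition indic_oc a b : R -> R := \1_(`]a, b]%classic).

Lemma indic_ocE a b y : indic_oc a b y = (y \in `]a, b])%:R.
Proof. by rewrite /indic_oc indicE mem_setE. Qed.

Lemma indic_oc_ge0 a b y : 0 <= indic_oc a b y.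
Proof. by rewrite indic_ocE. Qed.

Lemma integrable_indic_oc a b :
  lambda.-integrable setT (EFin \o indic_oc a b).
Proof. exact: integrable_indic_itv. Qed.

Lemma cintegrable_indic_oc a b :
  cintegrable lambda (fun y => (indic_oc a b y)%:C).
Proof.
apply: (@le_cintegrable _ (measurableTypeR R) R lambda _ (indic_oc a b)).
- by apply: cmeasurable_real; exact: measurable_indic.
- by move=> y; rewrite norm1_real ger0_norm// indic_oc_ge0.
- exact: integrable_indic_oc.
Qed.

Lemma Rintegral_indic_oc a b (f : R -> R) :
  (\int[lambda]_y (indic_oc a b y * f y))%R =
  (\int[lambda]_(y in `]a, b]) f y)%R.
Proof.
rewrite [RHS]Rintegral_mkcond; apply: eq_Rintegral => y _.
rewrite indic_ocE patchE mem_setE.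
by case: ifP => _; rewrite ?mul1r ?mul0r.
Qed.

Definition indic_hat a b w : R[i] :=
  cintegral lambda (fun y => (indic_oc a b y)%:C * expi (2 * pi * (w * y))).

Lemma norm1_cintegral d (T : measurableType d) (mu : {measure set T -> \bar R})
    (f : T -> R[i]) : cintegrable mu f ->
  norm1 (cintegral mu f) <= (\int[mu]_x norm1 (f x))%R.
Proof.
move=> [rf jf]; rewrite RintegralD//; try exact: integrable_norm.
by apply: lerD; exact: le_normr_Rintegral.
Qed.

(** The bound does not depend on [w]: the product of these constants over the sides of a box enters
    the dominating function in [fourier_box]. *)
Lemma norm1_indic_hat a b w :
  norm1 (indic_hat a b w) <= (\int[lambda]_y (2 * indic_oc a b y))%R.
Proof.
have mw : measurable_fun setT
    ((fun y => 2 * pi * (w * y)) : measurableTypeR R -> R).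
  by apply: measurable_funM => //; exact: mulrl_measurable.
have i := cintegrable_expi (cintegrable_indic_oc a b) mw.
apply: le_trans (norm1_cintegral i) _.
apply: le_Rintegral => //; first exact: cintegrable_norm1.
  have := integrableZl measurableT 2 (integrable_indic_oc a b).
  by apply: (eq_integrable measurableT) => y _; rewrite /= EFinM.
move=> y _; apply: le_trans (norm1M _ _) _.
rewrite norm1_real ger0_norm ?indic_oc_ge0// mulrC.
by rewrite ler_wpM2r ?indic_oc_ge0// norm1_expi.
Qed.

Lemma measurable_phase t : measurable_fun setT
  (fun p : measurableTypeR R * measurableTypeR R => 2 * pi * (p.1 * (p.2 - t))).
Proof.
apply: measurable_funM => //; apply: measurable_funM => //.
by apply: measurable_funB.
Qed.

Lemma cintegrable_damp_indic e a b t : 0 < e ->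
  cintegrable (lambda \x lambda)%E (fun p : measurableTypeR R * measurableTypeR R =>
    (damp e p.1)%:C * (indic_oc a b p.2)%:C * expi (2 * pi * (p.1 * (p.2 - t)))).
Proof.
move=> e0; apply: cintegrable_expi; last exact: measurable_phase.
exact: (cintegrable_tensor (cintegrable_damp e0) (cintegrable_indic_oc a b)).
Qed.

Lemma cintegral_damp_indicE e a b t w :
  cintegral lambda (fun y => (damp e w)%:C * (indic_oc a b y)%:C *
    expi (2 * pi * (w * (y - t)))) =
  (damp e w)%:C * indic_hat a b w * expi (- (2 * pi * (t * w))).
Proof.
have mw : measurable_fun setT
    ((fun y => 2 * pi * (w * y)) : measurableTypeR R -> R).
  by apply: measurable_funM => //; exact: mulrl_measurable.
have i := cintegrable_expi (cintegrable_indic_oc a b) mw.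
rewrite mulrAC -cintegralZl//; apply: eq_cintegral => y.
rewrite mulrBr mulrBr expiD [w * t]mulrC.
by ring.
Qed.

Lemma cintegrable_test e a b : 0 < e ->
  cintegrable lambda (fun w => (damp e w)%:C * indic_hat a b w).
Proof.
move=> e0; have [+ _] := cfubini1 (cintegrable_damp_indic a b 0 e0).
rewrite /=; congr cintegrable; apply/funext => w.
by rewrite cintegral_damp_indicE mul0r mulr0 oppr0 expi0 mulr1.
Qed.

(** Fubini supplies the measurability: the product with [damp 1] is integrable, hence measurable,
    and [damp 1] is continuous and nowhere zero, so it can be divided out. *)
Lemma cmeasurable_indic_hat a b :
  cmeasurable (indic_hat a b : measurableTypeR R -> R[i]).
Proof.
have m1 := cintegrable_measurable (cintegrable_test a b (@ltr01 R)).
have m2 : cmeasurable ((fun w => ((damp 1 w)^-1)%:C) : measurableTypeR R -> R[i]).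
  apply: cmeasurable_real; apply: continuous_measurable_fun => w.
  by apply: cvgV; [rewrite gt_eqF// damp_gt0|exact: continuous_damp].
have := cmeasurableM m2 m1; congr cmeasurable; apply/funext => w.
by rewrite mulrA -rmorphM mulVf ?mul1r// gt_eqF// damp_gt0.
Qed.

(** The Poisson integral of the indicator of []a, b]], that is, the integral over y in []a, b]] of
    the Poisson kernel centred at t. *)
Definition smoothed e a b t : R :=
  (atan (2 * pi / e * (b - t)) - atan (2 * pi / e * (a - t))) / pi.

Lemma is_derive_atan_poisson e t y : 0 < e ->
  is_derive y (1 : R) (fun y => pi^-1 * atan (2 * pi / e * (y - t)))
    (poisson e (2 * pi * (y - t))).
Proof.
move=> e0; pose c : R := 2 * pi / e.
have d1 : is_derive y (1 : R) (fun y => c * (y - t)) c.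
  have d0 : is_derive y (1 : R) (fun y => y - t) 1.
    have := @is_deriveB _ _ _ _ _ _ _ _ _ (is_derive_id y (1 : R))
      (is_derive_cst t y (1 : R)).
    by rewrite subr0.
  by have := is_deriveZ c d0; rewrite [_ *: 1]mulr1.
have d2 := @is_derive1_comp _ atan (fun y => c * (y - t)) y _ _
  (is_derive1_atan _) d1.
have := is_deriveZ pi^-1 d2; congr is_derive.
rewrite /GRing.scale/= /poisson /c; clear d1 d2 c.
have : pi != 0 :> R by rewrite gt_eqF// pi_gt0.
move: pi => p p0; field.
by rewrite p0 !gt_eqF// ltr_pwDl ?exprn_gt0 ?sqr_ge0.
Qed.

Lemma continuous_poisson e t : 0 < e ->
  continuous (fun y => poisson e (2 * pi * (y - t))).
Proof.
move=> e0 y; apply: cvgM; first exact: cvg_cst.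
have d0 : e ^+ 2 + (2 * pi * (y - t)) ^+ 2 != 0.
  by apply: lt0r_neq0; rewrite ltr_pwDl ?exprn_gt0 ?sqr_ge0.
apply: cvgV => //; apply: cvgD; first exact: cvg_cst.
under eq_fun do rewrite expr2; rewrite expr2.
suff h : (2 * pi * (y0 - t)) @[y0 --> y] --> 2 * pi * (y - t) by exact: cvgM.
apply: cvgM; first exact: cvg_cst.
by apply: cvgB; [exact: cvg_id|exact: cvg_cst].
Qed.

Lemma Rintegral_poisson e a b t : 0 < e -> a < b ->
  (\int[lambda]_(y in `]a, b]) poisson e (2 * pi * (y - t)))%R =
  smoothed e a b t.
Proof.
move=> e0 ab; have cP := @continuous_poisson e t e0.
have dP y := @is_derive_atan_poisson e t y e0.
rewrite /Rintegral integral_itv_obnd_cbnd; last first.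
  apply/measurable_EFinP; apply: measurable_funTS.
  exact: continuous_measurable_fun.
pose F (y : R) := pi^-1 * atan (2 * pi / e * (y - t)).
have cF y : {for y, continuous F}.
  by apply: differentiable_continuous; apply/derivable1_diffP; have [] := dP y.
rewrite (@continuous_FTC2 _ _ F)//.
- by rewrite /= /F /smoothed -mulrBr mulrC.
- exact: continuous_subspaceT.
- split; first by move=> y _; have [] := dP y.
    by apply: cvg_at_right_filter; exact: cF.
  by apply: cvg_at_left_filter; exact: cF.
- by move=> y _; rewrite derive1E; have [] := dP y.
Qed.

Lemma cintegral_test e a b t : 0 < e -> a < b ->
  cintegral lambda (fun w =>
    (damp e w)%:C * indic_hat a b w * expi (- (2 * pi * (t * w)))) =
  (smoothed e a b t)%:C.
Proof.
move=> e0 ab.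
transitivity (cintegral lambda (fun w => cintegral lambda (fun y =>
    (damp e w)%:C * (indic_oc a b y)%:C * expi (2 * pi * (w * (y - t)))))).
  by apply: eq_cintegral => w; rewrite cintegral_damp_indicE.
(* With the w-integral innermost, the two phases have merged into one in y - t, and the transform of
   the Laplace kernel appears. *)
rewrite (cfubini (cintegrable_damp_indic a b t e0))/=.
transitivity (cintegral lambda (fun y =>
    (indic_oc a b y * poisson e (2 * pi * (y - t)))%:C)).
  apply: eq_cintegral => y.
  rewrite [in RHS]rmorphM/= -cintegral_damp_expi// -cintegralZl; last first.
    by apply: cintegrable_expi; [exact: cintegrable_damp|exact: mulrl_measurable].
  apply: eq_cintegral => w.
  rewrite [RHS]mulrA [in RHS](mulrC (indic_oc a b y)%:C).
  by congr (_ * expi _); rewrite [w * _]mulrC mulrA.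
apply: complexP; first by rewrite /= Rintegral_indic_oc Rintegral_poisson.
by rewrite /= /Rintegral integral0.
Qed.

Lemma measurable_smoothed e a b :
  measurable_fun setT (smoothed e a b : measurableTypeR R -> R).
Proof.
have matan (c : R) : measurable_fun setT
    ((fun t => atan (2 * pi / e * (c - t))) : measurableTypeR R -> R).
  apply: (measurableT_comp (f := @atan R)).
    by apply: continuous_measurable_fun => x; exact: continuous_atan.
  by apply: measurable_funM => //; exact: measurable_funB.
by apply: measurable_funM => //; apply: measurable_funB; exact: matan.
Qed.

Lemma norm_smoothed_le e a b t : `|smoothed e a b t| <= 1.
Proof.
have pi0 : 0 < pi :> R := pi_gt0 R.
rewrite normrM (gtr0_norm (x := pi^-1)) ?invr_gt0// ler_pdivrMr// mul1r.
have := atan_gtNpi2 (2 * pi / e * (b - t)).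
have := atan_ltpi2 (2 * pi / e * (b - t)).
have := atan_gtNpi2 (2 * pi / e * (a - t)).
have := atan_ltpi2 (2 * pi / e * (a - t)).
rewrite ler_norml; lra.
Qed.

Lemma cvg_damp w : damp n.+1%:R^-1 w @[n --> \oo] --> (1 : R).
Proof.
have h : n.+1%:R^-1 * `|w| @[n --> \oo] --> 0 * `|w|.
  by apply: cvgM; [exact: cvg_harmonic|exact: cvg_cst].
have := cvg_comp _ _ (cvgN h) (@continuous_expR R _).
by rewrite mul0r oppr0 expR0; apply.
Qed.

Lemma cvg_atan_harmonic (c : R) :
  atan (2 * pi / n.+1%:R^-1 * c) @[n --> \oo] --> Num.sg c * (pi / 2).
Proof.
have pos (x : R) : 0 < x ->
    atan (2 * pi / n.+1%:R^-1 * x) @[n --> \oo] --> pi / 2.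
  move=> x0; apply: (cvg_comp _ _ _ (@cvgy_atan R)).
  apply/cvgryPge => A; near=> n.
  rewrite invrK mulrAC -ler_pdivrMl ?mulr_gt0 ?pi_gt0//.
  apply: (@le_trans _ _ n%:R); last by rewrite ler_nat.
  near: n; exact: nbhs_infty_ger.
have [c0|c0|->] := ltgtP c 0.
- rewrite ltr0_sg// mulN1r.
  rewrite (_ : (fun n => _) = - (fun n => atan (2 * pi / n.+1%:R^-1 * - c))).
    by apply: cvgN; apply: pos; rewrite oppr_gt0.
  by apply/funext => n; rewrite /GRing.opp/= mulrN atanN opprK.
- by rewrite gtr0_sg// mul1r; exact: pos.
- rewrite sgr0 mul0r; under eq_cvg do rewrite mulr0 atan0.
  exact: cvg_cst.
Unshelve. all: by end_near. Qed.

(** The limit is half the difference of the signs of b - t and a - t. At an endpoint this is 1/2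
    instead of the value of the indicator, whence the two exclusions. *)
Lemma cvg_smoothed a b t : a < b -> t != a -> t != b ->
  smoothed n.+1%:R^-1 a b t @[n --> \oo] --> indic_oc a b t.
Proof.
move=> ab ta tb.
have -> : indic_oc a b t =
    (Num.sg (b - t) * (pi / 2) - Num.sg (a - t) * (pi / 2)) / pi.
  have : pi != 0 :> R by rewrite gt_eqF// pi_gt0.
  move: pi => p p0; rewrite indic_ocE in_itv/=.
  have [bt|bt|/eqP] := ltgtP b t; last by rewrite eq_sym (negbTE tb).
    have at' : a < t by exact: lt_trans bt.
    rewrite at'/= !ltr0_sg ?subr_lt0//; by field.
  rewrite gtr0_sg ?subr_gt0//.
  have [at'|at'|/eqP] := ltgtP a t; last by rewrite eq_sym (negbTE ta).
    by rewrite ltr0_sg ?subr_lt0//=; field.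
  by rewrite gtr0_sg ?subr_gt0//=; field.
apply: cvgM; last exact: cvg_cst.
by apply: cvgB; exact: cvg_atan_harmonic.
Qed.

End test_function.

(** * Functions determined by their integrals over boxes *)

Section box_determine.
Context {R : realType} {n : nat}.
Local Notation mu := (lebesgue_rV R n).
Implicit Types (a b : 'I_n -> R) (f g : 'rV[R]_n -> R).

(** Intersecting boxes may produce degenerate ones; being empty, they need no separate comparison of
    integrals. *)
Lemma box_set0 a b : (forall i, a i < b i) \/ box a b = set0.
Proof.
have [h|/existsNP[i /negP]] := pselect (forall i, a i < b i); first by left.
rewrite -leNgt => ba; right; rewrite -subset0 => v /(_ i).
rewrite in_itv/= => /andP[av vb].
by have := lt_le_trans (lt_le_trans av vb) ba; rewrite ltxx.
Qed.

(** Integrability is assumed on boxes only, so the argument is localised to a cube. There all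
    integrals are finite, so the sets whose traces on the cube give equal integrals are closed under
    complement and form a Dynkin system containing the boxes. Countably many cubes exhaust the
    space. *)
Lemma ae_eq_box f g :
  (forall a b, (forall i, a i < b i) ->
    [/\ mu.-integrable (box a b) (EFin \o f),
        mu.-integrable (box a b) (EFin \o g) &
        (\int[mu]_(x in box a b) f x = \int[mu]_(x in box a b) g x)%R]) ->
  {ae mu, forall x, f x = g x}.
Proof.
move=> fg.
have {}fg a b : [/\ mu.-integrable (box a b) (EFin \o f),
        mu.-integrable (box a b) (EFin \o g) &
        (\int[mu]_(x in box a b) f x = \int[mu]_(x in box a b) g x)%R].
  have [/fg//|->] := box_set0 a b.
  by rewrite !Rintegral_set0; split=> //; exact: integrable_set0.
suff fg_cube k : ae_eq mu (cube k) (EFin \o f) (EFin \o g).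
  have h k : {ae mu, forall x, cube k x -> f x = g x}.
    by apply: filterS (fg_cube k) => x h /h [].
  have := ae_foralln h; apply: filterS => x hx.
  have [k _ kx] : (\bigcup_k cube k) x by rewrite bigcup_cube.
  exact: hx kx.
have [iF iG fgD] := fg (fun=> - k%:R) (fun=> k%:R).
have mD : measurable (@cube R n k) by exact: measurable_box.
have iF' E : measurable E -> mu.-integrable (E `&` cube k) (EFin \o f).
  by move=> mE; apply: integrableS iF => //; exact: measurableI.
have iG' E : measurable E -> mu.-integrable (E `&` cube k) (EFin \o g).
  by move=> mE; apply: integrableS iG => //; exact: measurableI.
apply: integral_ae_eq => //; first exact: measurable_int iG.
move=> E ED mE.
suff H S : measurable S -> (\int[mu]_(x in S `&` cube k) f x =
    \int[mu]_(x in S `&` cube k) g x)%R.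
  have EE : E `&` cube k = E := setIidl ED.
  have := H E mE; rewrite EE => HE.
  have := iF' E mE; have := iG' E mE; rewrite EE => iGE iFE.
  rewrite -(fineK (integrable_fin_num mE iFE)).
  by rewrite -(fineK (integrable_fin_num mE iGE)); congr EFin.
move=> mS.
have {mS} : <<s [set X | exists a b, X = box a b] >> S.
  by rewrite -measurable_rV_boxE; exact: mS.
move: S; apply: (@dynkin_induction _ 'rV[R]_n _ (fun S =>
    (\int[mu]_(x in S `&` cube k) f x = \int[mu]_(x in S `&` cube k) g x)%R)).
- exact: measurable_rV_boxE.
- by move=> _ _ [a [b ->]] [c [d ->]]; rewrite boxI; eexists; eexists.
- by rewrite setTI.
- by move=> _ [a [b ->]]; rewrite boxI; have [] := fg (fun i => Num.max (a i) (- k%:R))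
    (fun i => Num.min (b i) k%:R).
- move=> {E ED mE} E mE PE.
  have split_int h : mu.-integrable (cube k) (EFin \o h) ->
      (\int[mu]_(x in cube k) h x = \int[mu]_(x in E `&` cube k) h x +
       \int[mu]_(x in ~` E `&` cube k) h x)%R.
    move=> ih; rewrite -Rintegral_setU.
    + by rewrite -setIUl setUv setTI.
    + exact: measurableI.
    + by apply: measurableI => //; exact: measurableC.
    + by rewrite -setIUl setUv setTI.
    + by apply/disj_setPS => x [[? _] [? _]].
  by move: fgD; rewrite (split_int _ iF) (split_int _ iG) PE => /addrI.
- move=> F mF tF PF.
  have sumint h : (forall E, measurable E ->
      mu.-integrable (E `&` cube k) (EFin \o h)) ->
      (\int[mu]_(x in \bigcup_i F i `&` cube k) h x)%R =
      fine (\sum_(i <oo) (\int[mu]_(x in F i `&` cube k) h x)%:E)%E.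
    move=> ih; rewrite /Rintegral setI_bigcupl integral_bigcup.
    + congr fine; apply: eq_eseriesr => i _.
      rewrite fineK//; apply: integrable_fin_num (ih _ (mF i)).
      exact: measurableI.
    + by apply: trivIset_setIr.
    + by move=> i; exact: measurableI.
    + by rewrite -setI_bigcupl; apply: ih; exact: bigcup_measurable.
  rewrite !sumint//; congr fine; apply: eq_eseriesr => i _.
  by rewrite PF.
Qed.

(** Written as a product of one-dimensional indicators so that [cintegral_prod] applies. *)
Definition indic_box a b (v : 'rV[R]_n) : R :=
  \prod_i indic_oc (a i) (b i) (v ord0 i).

Lemma indic_boxE a b : indic_box a b = \1_(box a b).
Proof.
apply/funext => v; rewrite indicE /indic_box.
have [vb|vb] := boolP (v \in box a b).
  by rewrite big1// => i _; rewrite indic_ocE; move: vb; rewrite inE => /(_ i) ->.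
have /existsNP[i /negP vi] : ~ forall i, v ord0 i \in `]a i, b i].
  by move=> h; move/negP: vb; apply; rewrite inE.
by rewrite (bigD1 i)//= indic_ocE (negbTE vi) mul0r.
Qed.

Lemma cae_eq_box (f g : 'rV[R]_n -> R[i]) :
  (forall a b, (forall i, a i < b i) ->
    [/\ cintegrable mu (fun v => f v * (indic_box a b v)%:C),
        cintegrable mu (fun v => g v * (indic_box a b v)%:C) &
        cintegral mu (fun v => f v * (indic_box a b v)%:C) =
        cintegral mu (fun v => g v * (indic_box a b v)%:C)]) ->
  {ae mu, forall x, f x = g x}.
Proof.
move=> fg.
have ReE a b (h : 'rV[R]_n -> R[i]) :
    (fun v => complex.Re (h v * (indic_box a b v)%:C)) =
    (fun v => complex.Re (h v)) \_ (box a b).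
  apply/funext => v; rewrite Re_mul/= mulr0 subr0 indic_boxE indicE patchE.
  by case: ifP; rewrite ?mulr1 ?mulr0.
have ImE a b (h : 'rV[R]_n -> R[i]) :
    (fun v => complex.Im (h v * (indic_box a b v)%:C)) =
    (fun v => complex.Im (h v)) \_ (box a b).
  apply/funext => v; rewrite Im_mul/= mulr0 add0r indic_boxE indicE patchE.
  by case: ifP; rewrite ?mulr1 ?mulr0.
have int_mkcond a b (h : 'rV[R]_n -> R) :
    mu.-integrable setT (EFin \o (h \_ (box a b))) ->
    mu.-integrable (box a b) (EFin \o h).
  move=> ih; apply/(integrable_mkcond _ (measurable_box a b)).
  by rewrite restrict_EFin.
have rfg : {ae mu, forall x, complex.Re (f x) = complex.Re (g x)}.
  apply: (@ae_eq_box (fun v => complex.Re (f v)) (fun v => complex.Re (g v))).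
  move=> a b ab; have [[i1 _] [i2 _] e] := fg a b ab.
  split.
  - apply: int_mkcond; rewrite -(ReE a b f); exact: i1.
  - by apply: int_mkcond; rewrite -(ReE a b g); exact: i2.
  - rewrite Rintegral_mkcond [RHS]Rintegral_mkcond -(ReE a b f) -(ReE a b g).
    by move: e; rewrite /cintegral => -[e1 e2]; exact: e1.
have jfg : {ae mu, forall x, complex.Im (f x) = complex.Im (g x)}.
  apply: (@ae_eq_box (fun v => complex.Im (f v)) (fun v => complex.Im (g v))).
  move=> a b ab; have [[_ i1] [_ i2] e] := fg a b ab.
  split.
  - apply: int_mkcond; rewrite -(ImE a b f); exact: i1.
  - by apply: int_mkcond; rewrite -(ImE a b g); exact: i2.
  - rewrite Rintegral_mkcond [RHS]Rintegral_mkcond -(ImE a b f) -(ImE a b g).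
    by move: e; rewrite /cintegral => -[e1 e2]; exact: e2.
by apply: filterS2 rfg jfg => x; exact: complexP.
Qed.

(** A coordinate hyperplane is a product set with one side a point; the product of lengths is 0 even
    though the other sides are infinite. This discards the endpoints excluded in [cvg_smoothed]. *)
Lemma ae_coord_neq (c : 'I_n -> R) :
  {ae mu, forall v : 'rV[R]_n, forall i, v ord0 i != c i}.
Proof.
have h i : {ae mu, forall v : 'rV[R]_n, v ord0 i != c i}.
  pose A (j : 'I_n) : set (measurableTypeR R) :=
    if j == i then [set c i] else setT.
  have mA j : measurable (A j) by rewrite /A; case: ifP.
  exists [set v : 'rV[R]_n | forall j, A j (v ord0 j)]; split.
  - exact: measurable_prod_rV.
  - rewrite lebesgue_rV_box// (bigD1 i)//= /A eqxx.
    by rewrite lebesgue_measure_set1 mul0e.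
  - move=> v /= /negP; rewrite negbK => /eqP vi j.
    by rewrite /A; case: eqP => // ->.
exact: filter_forall.
Qed.

End box_determine.

(** * Fourier inversion in L^1 *)

Section fourier.
Context {R : realType} {n : nat}.
Local Notation mu := (lebesgue_rV R n).
Implicit Types (h H : 'rV[R]_n -> R[i]) (t w : 'rV[R]_n) (a b : 'I_n -> R).

Definition dot t w : R := \sum_i t ord0 i * w ord0 i.

Lemma dotC t w : dot t w = dot w t.
Proof. by apply: eq_bigr => i _; rewrite mulrC. Qed.

Lemma measurable_dot : measurable_fun setT
  (fun p : 'rV[measurableTypeR R]_n * 'rV[measurableTypeR R]_n => dot p.1 p.2).
Proof.
apply: measurable_sum => i; apply: measurable_funM.
  exact: (measurableT_comp (measurable_coord_rV i) measurable_fst).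
exact: (measurableT_comp (measurable_coord_rV i) measurable_snd).
Qed.

Lemma measurable_dotr w : measurable_fun setT
  (fun t : 'rV[measurableTypeR R]_n => dot t w).
Proof.
apply: measurable_sum => i; apply: measurable_funM => //.
exact: measurable_coord_rV.
Qed.

Lemma measurable_dotl t : measurable_fun setT
  (fun w : 'rV[measurableTypeR R]_n => dot t w).
Proof. by under eq_fun do rewrite dotC; exact: measurable_dotr. Qed.

Definition fourier h w : R[i] :=
  cintegral mu (fun t => h t * expi (- (2 * pi * dot t w))).

Definition ifourier H t : R[i] :=
  cintegral mu (fun w => H w * expi (2 * pi * dot w t)).

(** The test function Phi_e of the overview. *)
Definition damped_box_hat (e : R) a b w : R[i] :=
  \prod_i ((damp e (w ord0 i))%:C * indic_hat (a i) (b i) (w ord0 i)).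

Lemma cintegrable_damped_box_hat e a b : 0 < e ->
  cintegrable mu (damped_box_hat e a b).
Proof.
move=> e0.
exact: (cintegral_prod (fun i => cintegrable_test (a i) (b i) e0)).1.
Qed.

Lemma fourier_damped_box_hat e a b t : 0 < e -> (forall i, a i < b i) ->
  cintegral mu (fun w => damped_box_hat e a b w * expi (- (2 * pi * dot t w))) =
  \prod_i (smoothed e (a i) (b i) (t ord0 i))%:C.
Proof.
move=> e0 ab.
pose phi i (x : measurableTypeR R) : R[i] :=
  (damp e x)%:C * indic_hat (a i) (b i) x * expi (- (2 * pi * (t ord0 i * x))).
have iphi i : cintegrable (@lebesgue_measure R) (phi i).
  apply: cintegrable_expi; first exact: cintegrable_test.
  under eq_fun do rewrite -mulNr.
  by apply: measurable_funM => //; exact: mulrl_measurable.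
transitivity (cintegral mu (fun w => \prod_i phi i (w ord0 i))).
  apply: eq_cintegral => w.
  by rewrite /dot mulr_sumr -sumrN expi_sum -big_split.
rewrite (cintegral_prod iphi).2; apply: eq_bigr => i _.
exact: cintegral_test.
Qed.

Lemma cintegrable_fourier_kernel h (phi : 'rV[R]_n -> R[i]) (s : R) :
  cintegrable mu h -> cintegrable mu phi ->
  cintegrable (mu \x mu)%E (fun p => h p.1 * phi p.2 * expi (s * dot p.1 p.2)).
Proof.
move=> ih iphi; apply: cintegrable_expi; first exact: cintegrable_tensor.
by apply: measurable_funM => //; exact: measurable_dot.
Qed.

(** The multiplication formula of Fourier analysis. The scalar [s] is free so that it covers the
    direct transform, at -2 pi, and the inverse one, at 2 pi. *)
Lemma fourier_multiplication h (phi : 'rV[R]_n -> R[i]) (s : R) :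
  cintegrable mu h -> cintegrable mu phi ->
  cintegral mu (fun w => cintegral mu (fun t => h t * expi (s * dot t w)) * phi w) =
  cintegral mu (fun t => h t * cintegral mu (fun w => phi w * expi (s * dot t w))).
Proof.
move=> ih iphi.
have msl t : measurable_fun setT
    (fun w : 'rV[measurableTypeR R]_n => s * dot t w).
  by apply: measurable_funM => //; exact: measurable_dotl.
have msr w : measurable_fun setT
    (fun t : 'rV[measurableTypeR R]_n => s * dot t w).
  by apply: measurable_funM => //; exact: measurable_dotr.
have := cfubini (cintegrable_fourier_kernel s ih iphi) => /= E.
transitivity (cintegral mu (fun w => cintegral mu (fun t =>
    h t * phi w * expi (s * dot t w)))).
  apply: eq_cintegral => w; rewrite -cintegralZr; last first.
    exact: (cintegrable_expi ih (msr w)).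
  by apply: eq_cintegral => t; rewrite mulrAC.
rewrite -E; apply: eq_cintegral => t.
rewrite -cintegralZl; last exact: (cintegrable_expi iphi (msl t)).
by apply: eq_cintegral => w; rewrite mulrA.
Qed.

Lemma cintegrable_indic_box a b :
  cintegrable mu (fun v => (indic_box a b v)%:C).
Proof.
have := (cintegral_prod (fun i => cintegrable_indic_oc (a i) (b i))).1.
by congr cintegrable; apply/funext => v; rewrite -rmorph_prod.
Qed.

Lemma cintegral_indic_box_expi a b w :
  cintegral mu (fun y => (indic_box a b y)%:C * expi (2 * pi * dot w y)) =
  \prod_i indic_hat (a i) (b i) (w ord0 i).
Proof.
pose phi i (x : measurableTypeR R) : R[i] :=
  (indic_oc (a i) (b i) x)%:C * expi (2 * pi * (w ord0 i * x)).
have iphi i : cintegrable (@lebesgue_measure R) (phi i).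
  apply: cintegrable_expi; first exact: cintegrable_indic_oc.
  by apply: measurable_funM => //; exact: mulrl_measurable.
rewrite -(cintegral_prod iphi).2; apply: eq_cintegral => y.
by rewrite /dot mulr_sumr expi_sum rmorph_prod -big_split.
Qed.

Lemma fourier_box h a b : cintegrable mu h -> cintegrable mu (fourier h) ->
  (forall i, a i < b i) ->
  cintegral mu (fun t => h t * (indic_box a b t)%:C) =
  cintegral mu (fun w => fourier h w * \prod_i indic_hat (a i) (b i) (w ord0 i)).
Proof.
move=> ih iH ab; set H := fourier h.
have e0 k : 0 < k.+1%:R^-1 :> R by rewrite invr_gt0.
have mcoord (f : 'I_n -> R -> R[i]) :
    (forall i, cmeasurable (f i : measurableTypeR R -> R[i])) ->
    cmeasurable (fun w : 'rV[measurableTypeR R]_n => \prod_i f i (w ord0 i)).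
  move=> mf; apply: cmeasurable_prod => i.
  exact: (cmeasurable_comp (measurable_coord_rV i) (mf i)).
pose u k := cintegral mu (fun w => H w * damped_box_hat k.+1%:R^-1 a b w).
have uE k : u k = cintegral mu
    (fun t => h t * \prod_i (smoothed k.+1%:R^-1 (a i) (b i) (t ord0 i))%:C).
  rewrite /u; under eq_fun do rewrite /H /fourier.
  have := fourier_multiplication (- (2 * pi)) ih
    (cintegrable_damped_box_hat a b (e0 k)).
  under eq_cintegral do under eq_cintegral do rewrite mulNr.
  move=> ->; apply: eq_cintegral => t.
  under eq_cintegral do rewrite mulNr.
  by rewrite fourier_damped_box_hat.
(* Two limits of one sequence, with e = 1/(k+1): on the side of [h], dominated by [norm1 h], and on
   the side of [H], dominated by a constant multiple of [norm1 H]. *)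
apply: (@cconverges_unique _ u).
- have -> : u = fun k => cintegral mu
      (fun t => h t * \prod_i (smoothed k.+1%:R^-1 (a i) (b i) (t ord0 i))%:C).
    by apply/funext.
  apply: (cdominated_convergence (g := fun t => norm1 (h t))).
  + move=> k; apply: cmeasurableM; first exact: (cintegrable_measurable ih).
    apply: (mcoord (fun i x => (smoothed k.+1%:R^-1 (a i) (b i) x)%:C)) => i.
    by apply: cmeasurable_real; exact: measurable_smoothed.
  + apply: cmeasurableM; first exact: (cintegrable_measurable ih).
    exact: cintegrable_measurable (cintegrable_indic_box a b).
  + apply: filterS2 (ae_coord_neq a) (ae_coord_neq b) => t ta tb.
    apply: cconvergesM; first exact: cconverges_cst.
    rewrite rmorph_prod; apply: cconverges_prod => i.
    by apply: cconverges_real; exact: cvg_smoothed.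
  + exact: cintegrable_norm1.
  + move=> k t; apply: le_trans (norm1M _ _) _.
    rewrite ler_piMr ?norm1_ge0//; apply: le_trans (norm1_prod _ _ _) _.
    apply: prodr_ile1 => i _; rewrite norm1_ge0 norm1_real.
    exact: norm_smoothed_le.
- pose C (i : 'I_n) : R :=
    (\int[lebesgue_measure]_y (2 * indic_oc (a i) (b i) y))%R.
  apply: (cdominated_convergence (g := fun w => \prod_i C i * norm1 (H w))).
  + move=> k; apply: cmeasurableM; first exact: (cintegrable_measurable iH).
    exact: cintegrable_measurable (cintegrable_damped_box_hat a b (e0 k)).
  + apply: cmeasurableM; first exact: (cintegrable_measurable iH).
    apply: (mcoord (fun i => indic_hat (a i) (b i))) => i.
    exact: cmeasurable_indic_hat.
  + apply: aeW => w; apply: cconvergesM; first exact: cconverges_cst.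
    apply: cconverges_prod => i; rewrite -[X in cconverges _ X]mul1r.
    apply: cconvergesM; last exact: cconverges_cst.
    by apply: cconverges_real; exact: cvg_damp.
  + have := integrableZl measurableT (\prod_i C i) (cintegrable_norm1 iH).
    by apply: (eq_integrable measurableT) => w _; rewrite /= EFinM.
  + move=> k w; apply: le_trans (norm1M _ _) _.
    rewrite mulrC ler_wpM2r ?norm1_ge0//; apply: le_trans (norm1_prod _ _ _) _.
    apply: ler_prod => i _; rewrite norm1_ge0/=.
    apply: le_trans (norm1M _ _) _; rewrite norm1_real gtr0_norm ?damp_gt0//.
    apply: (le_trans _ (norm1_indic_hat _ _ (w ord0 i))).
    by rewrite ler_piMl ?norm1_ge0// damp_le1// ltW.
Qed.

Lemma fourier_inversion h : cintegrable mu h -> cintegrable mu (fourier h) ->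
  {ae mu, forall t, h t = ifourier (fourier h) t}.
Proof.
move=> ih iH; apply: cae_eq_box => a b ab.
have iB := cintegrable_indic_box a b.
split.
- apply: (cintegrableMr (C := 1)) => //; first exact: (cintegrable_measurable iB).
  move=> v; rewrite norm1_real indic_boxE indicE.
  by case: (v \in _); rewrite ?normr1 ?normr0.
- have := (cfubini1 (cintegrable_fourier_kernel (2 * pi) iB iH)).1.
  congr cintegrable; apply/funext => t /=.
  rewrite [RHS]mulrC /ifourier -cintegralZl; last first.
    apply: (cintegrable_expi iH); apply: measurable_funM => //.
    exact: measurable_dotr.
  by apply: eq_cintegral => w; rewrite mulrA dotC.
- rewrite fourier_box//.
  (* The transform of the box is written out as an integral again, so that the multiplication
     formula moves the inverse transform onto [fourier h]. *)
  under eq_cintegral do rewrite -cintegral_indic_box_expi.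
  have := fourier_multiplication (2 * pi) iB iH.
  under eq_cintegral do rewrite mulrC.
  move=> E; under eq_cintegral do under eq_cintegral do rewrite dotC.
  rewrite E; apply: eq_cintegral => t; rewrite mulrC; congr (_ * _).
  by apply: eq_cintegral => w; rewrite dotC.
Qed.

End fourier.

(** * Convolution *)

Section convolution.
Context {R : realType} {n : nat}.
Local Notation mu := (lebesgue_rV R n).
Implicit Types (F G : 'rV[R]_n -> R[i]) (c : R) (t w : 'rV[R]_n).

Lemma dotDl t1 t2 w : dot (t1 + t2) w = dot t1 w + dot t2 w.
Proof. by rewrite /dot -big_split; apply: eq_bigr => i _; rewrite mxE mulrDl. Qed.

Lemma dotZl c t w : dot (c *: t) w = c * dot t w.
Proof. by rewrite /dot mulr_sumr; apply: eq_bigr => i _; rewrite mxE mulrA. Qed.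

Lemma dotNl t w : dot (- t) w = - dot t w.
Proof. by rewrite -scaleN1r dotZl mulN1r. Qed.

Lemma dotZr c t w : dot t (c *: w) = c * dot t w.
Proof. by rewrite dotC dotZl dotC. Qed.

Definition scaled_conv c F G t : R[i] :=
  cintegral mu (fun tau => F tau * G (c *: t - tau)).

Lemma scale_affineE c t tau : c *: t - tau = t *m c%:M + - tau.
Proof. by rewrite mul_mx_scalar. Qed.

Lemma measurable_scaled_diff c : measurable_fun setT
  (fun p : 'rV[measurableTypeR R]_n * 'rV[measurableTypeR R]_n =>
     c *: (p.2 : 'rV[R]_n) - p.1 : 'rV[measurableTypeR R]_n).
Proof.
apply: measurable_fun_rV => i; under eq_fun do rewrite !mxE.
apply: measurable_funB.
  apply: measurable_funM => //.
  exact: (measurableT_comp (measurable_coord_rV i) measurable_snd).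
exact: (measurableT_comp (measurable_coord_rV i) measurable_fst).
Qed.

Lemma unitmx_scalar c : c != 0 -> (c%:M : 'M[R]_n) \in unitmx.
Proof. by move=> c0; rewrite unitmxE det_scalar unitfE expf_neq0. Qed.

(** Tonelli with the t-integral innermost: for fixed tau, the substitution t |-> c t - tau makes it
    a constant multiple of the integral of [norm1] of [G], independently of tau. *)
Lemma cintegrable_scaled_conv_kernel c F G : c != 0 ->
  cintegrable mu F -> cintegrable mu G ->
  cintegrable (mu \x mu)%E (fun p => F p.1 * G (c *: p.2 - p.1)).
Proof.
move=> c0 iF iG.
have mF := cintegrable_measurable iF; have mG := cintegrable_measurable iG.
have mG' : cmeasurable (fun p : 'rV[measurableTypeR R]_n * 'rV[measurableTypeR R]_n =>
    G (c *: (p.2 : 'rV[R]_n) - p.1)).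
  exact: (cmeasurable_comp (measurable_scaled_diff c) mG).
have mF' : cmeasurable (fun p : 'rV[measurableTypeR R]_n * 'rV[measurableTypeR R]_n =>
    F p.1) by exact: cmeasurable_fst.
apply: cintegrable_lty; first exact: cmeasurableM.
pose K (p : 'rV[measurableTypeR R]_n * 'rV[measurableTypeR R]_n) : \bar R :=
  (norm1 (F p.1) * norm1 (G (c *: (p.2 : 'rV[R]_n) - p.1)))%:E.
have mK : measurable_fun setT K.
  by apply/measurable_EFinP; apply: measurable_funM; exact: measurable_norm1.
apply: (@le_lt_trans _ _ (\int[mu \x mu]_p K p)%E).
  apply: ge0_le_integral => //.
  - by move=> p _; rewrite lee_fin norm1_ge0.
  - by apply/measurable_EFinP/measurable_norm1; exact: cmeasurableM.
  - by move=> p _; rewrite lee_fin norm1M.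
rewrite fubini_tonelli1//; last first.
  by move=> p; rewrite lee_fin mulr_ge0// norm1_ge0.
have mN : measurable_fun setT (fun v : 'rV[measurableTypeR R]_n => (norm1 (G v))%:E).
  exact/measurable_EFinP/measurable_norm1.
have dc : `|\det (c%:M : 'M[R]_n)| != 0.
  by rewrite normr_eq0 -unitfE -unitmxE unitmx_scalar.
pose I := (\int[mu]_v (norm1 (G v))%:E)%E.
have inner tau : (\int[mu]_t K (tau, t) =
    (`|\det (c%:M : 'M[R]_n)|^-1 * norm1 (F tau))%:E * I)%E.
  rewrite /I -(ge0_integral_affine (- tau) (unitmx_scalar c0) mN); last first.
    by move=> v; rewrite lee_fin norm1_ge0.
  rewrite muleA -EFinM mulrAC mulVf// mul1r -ge0_integralZl//.
  - by apply: eq_integral => t _; rewrite /K /= EFinM scale_affineE.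
  - exact: (measurableT_comp mN (measurable_affine c%:M (- tau))).
  - by move=> v _; rewrite lee_fin norm1_ge0.
  - by rewrite lee_fin norm1_ge0.
rewrite /fubini_F; under eq_integral do rewrite inner.
rewrite ge0_integralZr//; last 3 first.
- apply/measurable_EFinP; apply: measurable_funM => //.
  exact: measurable_norm1.
- by move=> x _; rewrite lee_fin mulr_ge0 ?norm1_ge0 ?invr_ge0.
- by apply: integral_ge0 => v _; rewrite lee_fin norm1_ge0.
have iN := cintegrable_norm1 iF.
apply: lte_mul_pinfty.
- apply: integral_ge0 => v _.
  by rewrite lee_fin mulr_ge0 ?norm1_ge0 ?invr_ge0.
- apply: integrable_fin_num => //.
  have := integrableZl measurableT `|\det (c%:M : 'M[R]_n)|^-1 iN.
  by apply: (eq_integrable measurableT) => v _; rewrite EFinM.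
- exact/integrable_lty/cintegrable_norm1.
Qed.

Lemma cintegrable_scaled_conv c F G : c != 0 ->
  cintegrable mu F -> cintegrable mu G -> cintegrable mu (scaled_conv c F G).
Proof.
move=> c0 iF iG.
exact: (cfubini2 (cintegrable_scaled_conv_kernel c0 iF iG)).1.
Qed.

(* The integrand of scaled_conv is integrable only for almost every t, so phases
   in t move under its integral sign only almost everywhere. *)
Lemma fourier_scaled_conv c F G w : c != 0 ->
  cintegrable mu F -> cintegrable mu G ->
  (`|c| ^+ n)%:C * fourier (scaled_conv c F G) w =
  fourier F (c^-1 *: w) * fourier G (c^-1 *: w).
Proof.
move=> c0 iF iG.
have iK := cintegrable_scaled_conv_kernel c0 iF iG.
have mphase : measurable_fun setT
    (fun p : 'rV[measurableTypeR R]_n * 'rV[measurableTypeR R]_n =>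
      - (2 * pi) * dot p.2 w).
  apply: measurable_funM => //.
  exact: (measurableT_comp (measurable_dotr w) measurable_snd).
have := cfubini (cintegrable_expi iK mphase) => /= E.
have mD t : measurable_fun setT (fun tau : 'rV[measurableTypeR R]_n =>
    - (2 * pi) * dot tau t).
  by apply: measurable_funM; [exact: measurable_cst|exact: measurable_dotr].
have mD' : measurable_fun setT (fun t : 'rV[measurableTypeR R]_n =>
    - (2 * pi) * dot t w) := mD w.
have -> : fourier (scaled_conv c F G) w = cintegral mu (fun t => cintegral mu
    (fun tau => F tau * G (c *: t - tau) * expi (- (2 * pi) * dot t w))).
  apply: ae_eq_cintegral.
  - apply: cmeasurableM.
      exact: (cintegrable_measurable (cintegrable_scaled_conv c0 iF iG)).
    by under eq_fun do rewrite -mulNr; exact: (cmeasurable_expi mD').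
  - exact: (cintegrable_measurable (cfubini2 (cintegrable_expi iK mphase)).1).
  - apply: filterS (ae_cintegrable2 iK) => t /= it.
    by rewrite -mulNr [RHS]cintegralZr.
rewrite -E -cintegralZl; last first.
  exact: (cfubini1 (cintegrable_expi iK mphase)).1.
pose phi y := G y * expi (- (2 * pi) * dot y (c^-1 *: w)).
have iphi : cintegrable mu phi := cintegrable_expi iG (mD _).
have phiE tau t : phi (c *: t - tau) =
    G (c *: t - tau) * expi (- (2 * pi) * dot t w) *
    expi (2 * pi * dot tau (c^-1 *: w)).
  rewrite /phi -mulrA -expiD; congr (_ * expi _).
  rewrite dotDl dotNl !dotZl !dotZr.
  move: (dot t w) (dot tau w) (2 * pi) => x y p; field.
  exact: c0.
transitivity (cintegral mu (fun tau =>
    F tau * expi (- (2 * pi) * dot tau (c^-1 *: w)) * cintegral mu phi)).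
  apply: eq_cintegral => tau.
  have [i e] := cintegral_affine (- tau) (unitmx_scalar c0) iphi.
  (* The factor [|c| ^+ n] of the statement is the Jacobian of t |-> c t - tau. *)
  rewrite -e det_scalar normrX [RHS]mulrCA; congr (_ * _).
  rewrite -(cintegralZl _ i); apply: eq_cintegral => t.
  rewrite -scale_affineE phiE.
  have ee : expi (- (2 * pi) * dot tau (c^-1 *: w)) *
      expi (2 * pi * dot tau (c^-1 *: w)) = 1.
    by rewrite -expiD mulNr addNr expi0.
  move: (F tau) (G _) (expi _) (expi _) (expi (2 * pi * _)) ee.
  by move=> f g e1 e2 e3 ee; rewrite -[LHS]mulr1 -ee; ring.
rewrite cintegralZr; last exact: (cintegrable_expi iF (mD _)).
by rewrite /fourier /phi; congr (_ * _); apply: eq_cintegral => v; rewrite mulNr.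
Qed.

End convolution.

(** * Chirps and the free metaplectic transformation *)

Section chirp.
Context {R : realType} {N : nat}.
Local Notation mu := (lebesgue_rV R N).
Implicit Types (M : 'M[R]_(N + N)) (P : 'M[R]_N) (f g H : 'rV[R]_N -> R[i]).
Implicit Types (t u x y : 'rV[R]_N).

Lemma bformE x P y : bform x P y = dot (x *m P) y.
Proof. by rewrite /bform mxE; apply: eq_bigr => i _; rewrite !mxE. Qed.

Lemma dot_mulmxr x P y : dot x (y *m P^T) = dot (x *m P) y.
Proof.
have dotM (v w : 'rV[R]_N) : dot v w = (v *m w^T) ord0 ord0.
  by rewrite mxE; apply: eq_bigr => i _; rewrite mxE.
by rewrite !dotM trmx_mul trmxK mulmxA.
Qed.

Lemma bform_trmx x P y : bform x P^T y = bform y P x.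
Proof. by rewrite !bformE dotC dot_mulmxr. Qed.

Lemma bformDl x y P t : bform (x + y) P t = bform x P t + bform y P t.
Proof. by rewrite !bformE mulmxDl dotDl. Qed.

Lemma bformDr x y P t : bform t P (x + y) = bform t P x + bform t P y.
Proof. by rewrite -!(bform_trmx _ P t) bformDl. Qed.

Lemma bformZ (c : R) P t : bform (c *: t) P (c *: t) = c ^+ 2 * bform t P t.
Proof. by rewrite !bformE -scalemxAl dotZl dotZr mulrA expr2. Qed.

Lemma bformN x P y : bform (- x) P y = - bform x P y.
Proof. by rewrite !bformE mulNmx dotNl. Qed.

Lemma bform_parallelogram x y P :
  bform (x + y) P (x + y) + bform (x - y) P (x - y) =
  2 * (bform x P x + bform y P y).
Proof.
have bformNr z t : bform z P (- t) = - bform z P t.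
  by rewrite -!(bform_trmx _ P) bformN.
rewrite !bformDl !bformDr !bformN !bformNr; ring.
Qed.

Lemma measurable_bform P : measurable_fun setT
  (fun t : 'rV[measurableTypeR R]_N => bform t P t).
Proof.
under eq_fun do rewrite bformE.
apply: measurable_sum => i; apply: measurable_funM.
  exact: (measurableT_comp (measurable_coord_rV i) (measurable_mulmx P)).
exact: measurable_coord_rV.
Qed.

Definition chirp P f t : R[i] := f t * expi (pi * bform t P t).

Lemma measurable_chirp P (c : R) : measurable_fun setT
  (fun t : 'rV[measurableTypeR R]_N => c * bform t P t).
Proof.
by apply: measurable_funM; [exact: measurable_cst|exact: measurable_bform].
Qed.

Lemma cintegrable_chirp P f : cintegrable mu f -> cintegrable mu (chirp P f).
Proof. by move=> h; exact: (cintegrable_expi h (measurable_chirp P pi)). Qed.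

Lemma chirpK P f t : chirp P f t * expi (- pi * bform t P t) = f t.
Proof. by rewrite /chirp -mulrA -expiD mulNr subrr expi0 mulr1. Qed.

Lemma fmtE M f u : cintegrable mu f ->
  let Bi := invmx (ursubmx M) in
  fmt M f u = ((Num.sqrt `|\det (ursubmx M)|)^-1)%:C *
    (expi (pi * bform u (drsubmx M *m Bi) u) *
     fourier (chirp (Bi *m ulsubmx M) f) (u *m Bi^T)).
Proof.
move=> cf Bi; congr (_ * _); rewrite -cintegralZl; last first.
  apply: (cintegrable_expi (cintegrable_chirp _ cf)).
  apply: measurable_funN; apply: measurable_funM; first exact: measurable_cst.
  exact: measurable_dotr.
apply: eq_cintegral => t.
rewrite dot_mulmxr -bformE mulrDr /chirp -[in RHS]mulrA [RHS]mulrCA -!expiD.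
by congr (_ * expi _); rewrite addrA.
Qed.

(** The parallelogram identity at c t - tau and tau. Their sum c t carries the form of t twice, and
    their difference c t - 2 tau is twice c^-1 t - tau because c = 2 / c: this is where sqrt 2 comes
    from. *)
Lemma chirp_phase P t tau (c := Num.sqrt 2 : R) :
  2 * pi * bform (c^-1 *: t - tau) P (c^-1 *: t - tau) + pi * bform t P t =
  pi * bform tau P tau + pi * bform (c *: t - tau) P (c *: t - tau).
Proof.
have c2 : c ^+ 2 = 2 by rewrite sqr_sqrtr.
have c0 : c != 0 by rewrite gt_eqF// sqrtr_gt0.
have := bform_parallelogram (c *: t - tau) tau P.
rewrite subrK bformZ c2.
have -> : c *: t - tau - tau = 2 *: (c^-1 *: t - tau).
  rewrite scalerBr scalerA (_ : 2 * c^-1 = c); last by rewrite -c2 expr2 mulfK.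
  by rewrite scaler_nat mulr2n opprD addrA.
rewrite bformZ; move: (bform t P t) (bform (_ - _) P _) (bform (_ - _) P _).
move: (bform tau P tau) pi => x p y z w E.
have {}E : y + 2 * w = x + z by lra.
by rewrite -mulrDr -E; ring.
Qed.

Lemma cintegrable_fmconv_kernel P f g : cintegrable mu f -> cintegrable mu g ->
  cintegrable (mu \x mu)%E (fun p => f p.1 * g (Num.sqrt 2 *: p.2 - p.1) *
    expi (2 * pi * bform ((Num.sqrt 2)^-1 *: p.2 - p.1) P
                         ((Num.sqrt 2)^-1 *: p.2 - p.1))).
Proof.
move=> cf cg.
have c0 : Num.sqrt 2 != 0 :> R by rewrite gt_eqF// sqrtr_gt0.
apply: (cintegrable_expi (cintegrable_scaled_conv_kernel c0 cf cg)).
apply: (measurableT_comp (f := fun s : 'rV[measurableTypeR R]_N =>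
  2 * pi * bform s P s)); first exact: measurable_chirp.
exact: measurable_scaled_diff.
Qed.

Lemma cintegrable_fmconv M f g : cintegrable mu f -> cintegrable mu g ->
  cintegrable mu (fmconv M f g).
Proof.
move=> cf cg; apply: cintegrableZl.
exact: (cfubini2 (cintegrable_fmconv_kernel _ cf cg)).1.
Qed.

(** For almost every t, [chirp_phase] turns the chirp of the convolution into a multiple of the
    scaled convolution of the chirps. The factor sqrt 2 ^ N of [fmconv] is the Jacobian that
    [fourier_scaled_conv] leaves on its left-hand side. *)
Lemma fourier_chirp_fmconv M f g w : cintegrable mu f -> cintegrable mu g ->
  let P := invmx (ursubmx M) *m ulsubmx M in
  let c := (Num.sqrt 2)^-1 in
  fourier (chirp P (fmconv M f g)) w =
  ((Num.sqrt `|\det (ursubmx M)|)^-1)%:C *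
  (fourier (chirp P f) (c *: w) * fourier (chirp P g) (c *: w)).
Proof.
move=> cf cg P c.
have c0 : Num.sqrt 2 != 0 :> R by rewrite gt_eqF// sqrtr_gt0.
have cF := cintegrable_chirp P cf; have cG := cintegrable_chirp P cg.
have cS := cintegrable_scaled_conv c0 cF cG.
pose k : R[i] := (Num.sqrt 2 ^+ N / Num.sqrt `|\det (ursubmx M)|)%:C.
have mw : measurable_fun setT (fun t : 'rV[measurableTypeR R]_N =>
    - (2 * pi * dot t w)).
  apply: measurable_funN; apply: measurable_funM; first exact: measurable_cst.
  exact: measurable_dotr.
have -> : fourier (chirp P (fmconv M f g)) w =
    k * fourier (scaled_conv (Num.sqrt 2) (chirp P f) (chirp P g)) w.
  rewrite -cintegralZl; last exact: (cintegrable_expi cS mw).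
  apply: ae_eq_cintegral.
  - have cz := cintegrable_chirp P (cintegrable_fmconv M cf cg).
    exact: (cintegrable_measurable (cintegrable_expi cz mw)).
  - have cSw := cintegrable_expi cS mw.
    exact: (cintegrable_measurable (cintegrableZl k cSw)).
  - apply: filterS (ae_cintegrable2 (cintegrable_fmconv_kernel P cf cg)).
    move=> t /= it; rewrite [RHS]mulrA; congr (_ * _).
    rewrite /chirp /fmconv -mulrA; congr (_ * _).
    rewrite -[LHS](cintegralZr _ it); apply: eq_cintegral => tau.
    rewrite -[LHS]mulrA -expiD chirp_phase expiD.
    rewrite mulrACA; congr (_ * _).
rewrite -(fourier_scaled_conv w c0 cF cG) mulrA; congr (_ * _).
by rewrite /k (ger0_norm (sqrtr_ge0 2)) mulrC rmorphM.

Qed.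

End chirp.

(** * Product formula and reconstruction of the convolution *)

Unset Implicit Arguments.

Theorem theorem2 (R : realType) (N : nat) (M : 'M[R]_(N + N))
    (hM : free_symplectic M) (f g : 'rV[R]_N -> R[i])
    (hf : cintegrable (lebesgue_rV R N) f)
    (hg : cintegrable (lebesgue_rV R N) g) :
  let z := fmconv M f g in
  let FG := fun u : 'rV[R]_N =>
    fmt M f ((Num.sqrt 2)^-1 *: u) * fmt M g ((Num.sqrt 2)^-1 *: u) in
  (forall u : 'rV[R]_N, fmt M z u = FG u) /\
  (cintegrable (lebesgue_rV R N) FG ->
   {ae lebesgue_rV R N, forall t : 'rV[R]_N, z t = ifmt M FG t}).
Proof.
have [_ _ _ detB] := hM => z FG.
set B := ursubmx M in detB.
pose D := drsubmx M; pose Bi := invmx B; pose P := Bi *m ulsubmx M.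
pose kap : R := (Num.sqrt `|\det B|)^-1.
pose c : R := (Num.sqrt 2)^-1.
have cz : cintegrable (lebesgue_rV R N) z := cintegrable_fmconv M hf hg.
(* Each of the two transforms at u / sqrt 2 carries half of the quadratic phase in u; together they
   carry it once. *)
have c2 : c ^+ 2 *+ 2 = 1.
  by rewrite exprVn sqr_sqrtr// -mulr_natr mulVf// pnatr_eq0.
have zFG u : fmt M z u = FG u.
  rewrite /FG !fmtE// -/B -/Bi -/P -/D -/kap -/c fourier_chirp_fmconv//.
  rewrite -/B -/Bi -/P -/kap -/c -!scalemxAl bformZ.
  have EE (b : R) : expi (pi * (c ^+ 2 * b)) * expi (pi * (c ^+ 2 * b)) =
      expi (pi * b).
    by rewrite -expiD -mulrDr -mulrDl -mulr2n c2 mul1r.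
  rewrite -EE; move: (expi _) (fourier _ _) (fourier _ _) (kap%:C).
  by move=> e1 F G k; ring.
split=> // iFG; pose H := fourier (chirp P z).
have FGE u : FG u = kap%:C * (expi (pi * bform u (D *m Bi) u) * H (u *m Bi^T)).
  by rewrite -zFG fmtE.
have detB0 : 0 < `|\det B| by rewrite normr_gt0.
have kap0 : kap%:C != 0 by rewrite fmorph_eq0 invr_eq0 gt_eqF// sqrtr_gt0.
have uB : B \in unitmx by rewrite unitmxE unitfE.
(* Integrability passes from [FG] to [H]: removing [kap] and the chirp in u leaves [H] at u B^-T,
   and the substitution by B^T undoes the argument. *)
have iHB : cintegrable (lebesgue_rV R N) (fun u => H (u *m Bi^T)).
  have := cintegrableZl (kap%:C)^-1
    (cintegrable_expi iFG (measurable_chirp (D *m Bi) (- pi))).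
  congr cintegrable; apply/funext => u; rewrite FGE -!mulrA mulKf//.
  by rewrite mulrCA -expiD mulNr subrr expi0 mulr1.
have iH : cintegrable (lebesgue_rV R N) H.
  have uBT : B^T \in unitmx by rewrite unitmx_tr.
  have [+ _] := cintegral_affine 0 uBT iHB.
  congr cintegrable; apply/funext => v.
  by rewrite addr0 -mulmxA -trmx_mul mulVmx// trmx1 mulmx1.
apply: filterS (fourier_inversion (cintegrable_chirp P cz) iH) => t ht.
rewrite -(chirpK P z t) ht -/H.
pose phi w := H w * expi (2 * pi * dot w t).
have iphi : cintegrable (lebesgue_rV R N) phi.
  apply: (cintegrable_expi iH); apply: measurable_funM.
    exact: measurable_cst.
  exact: measurable_dotr.
have uBiT : Bi^T \in unitmx by rewrite unitmx_tr unitmx_inv.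
have [iphiB e] := cintegral_affine 0 uBiT iphi.
have -> : ifourier H t = cintegral (lebesgue_rV R N) phi by [].
rewrite /ifmt -/B -/Bi -/D -/kap -e.
(* The forms in the inverse kernel are the transposes of D B^-1 and P, hence have the same values:
   the chirp in u cancels that of [FG], and the chirp in t undoes that of z. *)
have -> : cintegral (lebesgue_rV R N) (fun u => FG u *
    expi (- pi * (bform u (Bi^T *m D^T) u +
                  bform t ((ulsubmx M)^T *m Bi^T) t) +
          2 * pi * bform u Bi^T t)) =
    cintegral (lebesgue_rV R N) (fun u =>
      kap%:C * expi (- pi * bform t P t) * phi (u *m Bi^T + 0)).
  apply: eq_cintegral => u; rewrite addr0 FGE -!trmx_mul !bform_trmx /phi.
  rewrite [dot _ t]dotC dot_mulmxr -bformE mulrDr !expiD.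
  have : expi (pi * bform u (D *m Bi) u) * expi (- pi * bform u (D *m Bi) u) = 1.
    by rewrite -expiD mulNr subrr expi0.
  rewrite -/P; move: (expi _) (expi _) (expi _) (expi _) (H _) (kap%:C).
  move=> e1 e2 e3 e4 h k E.
  by rewrite -[RHS]mulr1 -E; ring.
rewrite (cintegralZl _ iphiB).
(* The Jacobian |det B|^-1 of w = u B^-T is the product of the normalisations of [fmt] and
   [ifmt]. *)
have kk : (`|\det Bi^T|)%:C = kap%:C * kap%:C.
  rewrite -rmorphM; congr (_%:C).
  by rewrite /kap -invfM -expr2 sqr_sqrtr// det_tr det_inv normfV.
by rewrite kk -!mulrA; congr (_ * (_ * _)); rewrite mulrC.
Qed.
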